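(* Let $u\in S$ be a $2$-bounded monomial of degree $4$ such that $x_1^2\nmid u$. Then $B_2(u)$ is Freiman if and only if $u=x_1x_2x_3^2$, or $u=x_2^2x_3^2$, or $u=x_1x_2^2x_{i_4}$ for some $i_4$ with $3\le i_4\le n$.
   Context: Throughout, $n\ge 3$ is an integer, $K$ is a field, $S=K[x_1,\ldots,x_n]$ is the polynomial ring and $\mathfrak m=(x_1,\ldots,x_n)$. For a monomial ideal $I\subset S$, $G(I)$ is its unique minimal set of monomial generators and $\mu(I)=|G(I)|$. $I$ is equigenerated if all elements of $G(I)$ have the same degree. The analytic spread $\ell(I)$ is the Krull dimension of the fiber ring $F(I)=\bigoplus_{k\ge 0}I^k/\mathfrak m I^k$. An equigenerated monomial ideal $I$ is called Freiman if $\mu(I^2)=\ell(I)\mu(I)-\binom{\ell(I)}{2}$. For a monomial $u$, $\mathrm{supp}(u)=\{i: x_i\mid u\}$. Let $k$ be a positive integer. A monomial $x_1^{a_1}\cdots x_n^{a_n}$ is $k$-bounded if $a_i\le k$ for all $i$. A monomial ideal $I$ generated by $k$-bounded monomials is $k$-Borel if for every $k$-bounded monomial $u\in I$, every $j\in\mathrm{supp}(u)$ and every $i<j$ one has $x_i(u/x_j)\in I$ provided $x_i(u/x_j)$ is again $k$-bounded. For a $k$-bounded monomial $u$, $B_k(u)$ is the unique smallest (with respect to inclusion) $k$-Borel ideal containing $u$. *)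

(* Defs.v *)
From HB Require Import structures.
From mathcomp Require Import all_boot all_order all_algebra finmap.
From mathcomp Require Import boolp.
From mathcomp Require Import mpoly.

Set Implicit Arguments.
Unset Strict Implicit.
Unset Printing Implicit Defensive.

Import GRing.Theory.
Local Open Scope ring_scope.

(* Ideals are boolean predicates {pred R}; since boolp provides asbool
   ( `[< P >] ), every Prop-valued subset of R is of this form.              *)

Section Ideals.
Variable R : comNzRingType.
Implicit Types (A : R -> Prop) (I J : {pred R}).

Definition ideal_gen A : {pred R} := fun x =>
  `[< exists s : seq (R * R),
        (forall c, c \in s -> A c.2) /\ x = \sum_(c <- s) c.1 * c.2 >].

Definition ideal_mul I J : {pred R} :=
  ideal_gen (fun x => exists a b, [/\ a \in I, b \in J & x = a * b]).

Fixpoint ideal_exp I (k : nat) : {pred R} :=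
  if k is k'.+1 then ideal_mul I (ideal_exp I k') else predT.

Lemma ideal_gen0 A : 0 \in ideal_gen A.
Proof. by apply/asboolP; exists [::]; rewrite big_nil. Qed.

Lemma ideal_gen_mem A x : A x -> x \in ideal_gen A.
Proof.
move=> Ax; apply/asboolP; exists [:: (1, x)]; rewrite big_seq1 mul1r; split=> //.
by move=> c; rewrite inE => /eqP->.
Qed.

Lemma ideal_genD A x y :
  x \in ideal_gen A -> y \in ideal_gen A -> x + y \in ideal_gen A.
Proof.
move=> /asboolP[s [sA ->]] /asboolP[t [tA ->]]; apply/asboolP.
exists (s ++ t); rewrite big_cat; split=> // c.
by rewrite mem_cat => /orP[/sA|/tA].
Qed.

Lemma ideal_genM A a x : x \in ideal_gen A -> a * x \in ideal_gen A.
Proof.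
move=> /asboolP[s [sA ->]]; apply/asboolP.
exists [seq (a * c.1, c.2) | c <- s]; split.
  by move=> c /mapP[d ds ->]; apply: (sA d).
by rewrite big_map mulr_sumr; apply: eq_bigr => c _; rewrite mulrA.
Qed.

Lemma ideal_gen_sum A (T : Type) (r : seq T) (P : pred T) (F : T -> R) :
  (forall i, P i -> F i \in ideal_gen A) ->
  \sum_(i <- r | P i) F i \in ideal_gen A.
Proof.
move=> FA; elim/big_ind: _ => //; [exact: ideal_gen0 | exact: ideal_genD].
Qed.

Lemma ideal_gen_ind A (Q : R -> Prop) :
  Q 0 -> (forall x y, Q x -> Q y -> Q (x + y)) ->
  (forall a x, Q x -> Q (a * x)) -> (forall x, A x -> Q x) ->
  forall x, x \in ideal_gen A -> Q x.
Proof.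
move=> Q0 QD QM AQ x /asboolP[s [sA ->]]; rewrite big_seq.
by elim/big_ind: _ => // c /sA/AQ; apply: QM.
Qed.

Lemma ideal_exp0 I k : 0 \in ideal_exp I k.
Proof. by case: k => [|k] //; apply: ideal_gen0. Qed.

Lemma ideal_expD I k x y :
  x \in ideal_exp I k -> y \in ideal_exp I k -> x + y \in ideal_exp I k.
Proof. by case: k => [|k] //; apply: ideal_genD. Qed.

Lemma ideal_expMl I k a x : x \in ideal_exp I k -> a * x \in ideal_exp I k.
Proof. by case: k => [|k] //; apply: ideal_genM. Qed.

Lemma ideal_exp_sum I k (T : Type) (r : seq T) (P : pred T) (F : T -> R) :
  (forall i, P i -> F i \in ideal_exp I k) ->
  \sum_(i <- r | P i) F i \in ideal_exp I k.
Proof. by case: k => [|k] //; apply: ideal_gen_sum. Qed.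

Lemma ideal_exp_add I k l x y :
  x \in ideal_exp I k -> y \in ideal_exp I l -> x * y \in ideal_exp I (k + l).
Proof.
move=> + yI; elim: k x => [|k IHk] x; first by move=> _; apply: ideal_expMl.
apply: (@ideal_gen_ind _ (fun z => z * y \in ideal_exp I (k.+1 + l))).
- by rewrite mul0r; apply: ideal_exp0.
- by move=> a b; rewrite mulrDl; apply: ideal_expD.
- by move=> a b; rewrite -mulrA; apply: ideal_expMl.
move=> _ [a [b [aI bI ->]]]; rewrite -mulrA; apply: ideal_gen_mem.
by exists a, (b * y); split=> //; apply: IHk.
Qed.

End Ideals.

Definition prime_chain (R : comNzRingType) (d : nat) : Prop :=
  exists P : 'I_d.+1 -> prime_idealr R, forall i j : 'I_d.+1, (i < j)%N ->
    {subset (P i : {pred R}) <= (P j : {pred R})} /\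
    ~ {subset (P j : {pred R}) <= (P i : {pred R})}.

Definition krull_dim_eq (R : comNzRingType) (d : nat) : Prop :=
  prime_chain R d /\ forall e, prime_chain R e -> (e <= d)%N.

Section FiberRing.
Variables (n : nat) (K : fieldType).
Local Notation S := {mpoly K[n]}.

Definition max_ideal : {pred S} := ideal_gen (fun p => exists i, p = 'X_i).

Lemma max_ideal_coef0 (p : S) : p \in max_ideal -> p@_0%MM = 0.
Proof.
move: p; apply: ideal_gen_ind => [|p q|a p|_ [i ->]].
- by rewrite mcoeff0.
- by rewrite mcoeffD => -> ->; rewrite addr0.
- by rewrite rmorphM /= => ->; rewrite mulr0.
- by rewrite mcoeffX mnm1_eq0.
Qed.

Variable I : {pred S}.

(* The Rees algebra (+)_k I^k t^k, as a subring of S[t].                     *)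
Definition rees_pred : {pred {poly S}} :=
  fun f => `[< forall k, f`_k \in ideal_exp I k >].

Lemma rees_predP (f : {poly S}) : reflect (forall k, f`_k \in ideal_exp I k) (f \in rees_pred).
Proof. exact: asboolP. Qed.

Lemma rees_subring : subring_closed rees_pred.
Proof.
split=> [|f g /rees_predP fI /rees_predP gI|f g /rees_predP fI /rees_predP gI].
- by apply/rees_predP=> -[|k] //; rewrite coef1 ideal_exp0.
- apply/rees_predP=> k; rewrite coefB -mulN1r.
  by apply: ideal_expD => //; apply: ideal_expMl.
- apply/rees_predP=> k; rewrite coefM.
  apply: ideal_exp_sum => i _.
  by rewrite -[k in ideal_exp I k](subnKC (ltn_ord i : (i <= k)%N)); apply: ideal_exp_add.
Qed.

HB.instance Definition _ :=
  GRing.isSubringClosed.Build {poly S} rees_pred rees_subring.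

Record rees := Rees { rees_val :> {poly S}; _ : rees_val \in rees_pred }.

HB.instance Definition _ := [isSub for rees_val].
HB.instance Definition _ := [Choice of rees by <:].
HB.instance Definition _ := [SubChoice_isSubComNzRing of rees by <:].

Definition rees_max : {pred rees} :=
  fun f => `[< forall k, (f : {poly S})`_k \in ideal_mul max_ideal (ideal_exp I k) >].

Lemma rees_maxP (f : rees) :
  reflect (forall k, (f : {poly S})`_k \in ideal_mul max_ideal (ideal_exp I k))
          (f \in rees_max).
Proof. exact: asboolP. Qed.

Lemma rees_max_idealr : idealr_closed rees_max.
Proof.
split.
- by apply/rees_maxP=> k; rewrite coef0 ideal_gen0.
- apply/negP => /rees_maxP/(_ 0%N); rewrite coef1 /= => h1.
  have /max_ideal_coef0 : 1 \in max_ideal.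
    apply: (@ideal_gen_ind _ _ (fun x => x \in max_ideal)) h1.
    + exact: ideal_gen0.
    + exact: ideal_genD.
    + exact: ideal_genM.
    + by move=> _ [a [b [am _ ->]]]; rewrite mulrC; apply: ideal_genM.
  by rewrite mcoeff1 eqxx => /eqP; rewrite oner_eq0.
move=> [a aI] f g /rees_maxP fI /rees_maxP gI; apply/rees_maxP=> k /=.
rewrite coefD; apply: ideal_genD => //=; rewrite coefM; apply: ideal_gen_sum => i _.
have aiI : a`_i \in ideal_exp I i by move/rees_predP: aI.
have {fI} := fI (k - i)%N; move: (_`_(k - i)) => x.
move: x; apply: (@ideal_gen_ind _ _
  (fun x => a`_i * x \in ideal_mul max_ideal (ideal_exp I k))).
- by rewrite mulr0; apply: ideal_gen0.
- by move=> x y; rewrite mulrDr; apply: ideal_genD.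
- by move=> b x; rewrite mulrCA; apply: ideal_genM.
move=> _ [x [y [xm yI ->]]]; rewrite mulrCA; apply: ideal_gen_mem.
exists x, (a`_i * y); split=> //.
by have := ideal_exp_add aiI yI; rewrite subnKC // -ltnS.
Qed.

HB.instance Definition _ := isIdealr.Build rees rees_max rees_max_idealr.

(* Coordinatewise, the quotient of (+)_k I^k t^k by (+)_k m I^k t^k is
   (+)_k I^k / m I^k.                                                        *)
Definition fiber_ring : comNzRingType := {ideal_quot rees_max}.

End FiberRing.

Section MonomialIdeals.
Variables (n : nat) (K : fieldType).
Local Notation S := {mpoly K[n]}.
Implicit Types (I J : {pred S}) (u : 'X_{1..n}).

Definition mon_ideal (A : 'X_{1..n} -> Prop) : {pred S} :=
  ideal_gen (fun p => exists2 m, A m & p = 'X_[m]).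

Definition min_mon_gens I (G : {fset 'X_{1..n}}) : Prop :=
  I =i mon_ideal (fun m => m \in G) /\
  forall H : {fset 'X_{1..n}}, (H `<=` G)%fset ->
    I =i mon_ideal (fun m => m \in H) -> H = G.

(* G and G2 are G(I) and G(I^2), which are unique, and so is l = l(I): quantifying
   them existentially or universally makes no difference.                    *)
Definition freiman I : Prop :=
  exists (G G2 : {fset 'X_{1..n}}) (l : nat),
    [/\ min_mon_gens I G,
        {in G &, forall a b, mdeg a = mdeg b},
        min_mon_gens (ideal_exp I 2) G2,
        krull_dim_eq (fiber_ring I) l
      & #|` G2|%:Z = l%:Z * #|` G|%:Z - 'C(l, 2)%:Z].

Definition kbounded k u : Prop := forall i, (u i <= k)%N.

Definition kBorel k I : Prop :=
  (exists2 A : 'X_{1..n} -> Prop,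
     forall m, A m -> kbounded k m & I =i mon_ideal A) /\
  forall u (i j : 'I_n), kbounded k u -> 'X_[u] \in I ->
    (0 < u j)%N -> (i < j)%N ->
    kbounded k (U_(i) + (u - U_(j)))%MM -> 'X_[U_(i) + (u - U_(j))] \in I.

(* The smallest k-Borel ideal containing u, as the intersection of all of them;
   see kBorel_gen_kBorel, kBorel_gen_mem and kBorel_gen_min below.           *)
Definition kBorel_gen k u : {pred S} :=
  fun p => `[< forall J, kBorel k J -> 'X_[u] \in J -> p \in J >].

Lemma kBorel_genP k u p :
  reflect (forall J, kBorel k J -> 'X_[u] \in J -> p \in J) (p \in kBorel_gen k u).
Proof. exact: asboolP. Qed.

Lemma mon_ideal_coef A (p : S) m : p \in mon_ideal A -> m \in msupp p ->
  exists2 a, A a & (a <= m)%MM.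
Proof.
move=> pA; rewrite mcoeff_msupp; apply: contraNP => nA; apply/eqP.
suff: forall m', (m' <= m)%MM -> p@_m' = 0 by apply; apply: lepm_refl.
move: p pA; apply: ideal_gen_ind => [m' _|p q p0 q0 m' m'm|a p p0 m' m'm|].
- by rewrite mcoeff0.
- by rewrite mcoeffD p0 ?q0 ?addr0.
- rewrite mcoeffM big1 // => -[k1 k2] /= /eqP em.
  rewrite p0 ?mulr0 //; apply: lepm_trans m'm.
  by rewrite [X in (_ <= X)%MM]em lem_addl.
move=> _ [a Aa ->] m' m'm; rewrite mcoeffX.
by case: eqP => // am; case: nA; exists a; rewrite // am.
Qed.

Lemma mon_idealX A a m : A a -> (a <= m)%MM -> 'X_[m] \in mon_ideal A.
Proof.
move=> Aa am; rewrite -(submK am) mpolyXD; apply: ideal_genM.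
by apply: ideal_gen_mem; exists a.
Qed.

Lemma mon_ideal_msupp A (p : S) :
  (forall m, m \in msupp p -> 'X_[m] \in mon_ideal A) -> p \in mon_ideal A.
Proof.
move=> pA; rewrite [p]mpolyE big_seq; apply: ideal_gen_sum => m /pA mA.
by rewrite -mul_mpolyC; apply: ideal_genM.
Qed.

Lemma kBorel_gen_kBorel k u : kBorel k (kBorel_gen k u).
Proof.
split; last first.
  move=> m i j mk /kBorel_genP mB mj ij mk'; apply/kBorel_genP=> J JB uJ.
  by case: (JB) => _; apply=> //; apply: mB.
exists (fun m => kbounded k m /\ 'X_[m] \in kBorel_gen k u); first by move=> m [].
move=> p; apply/idP/idP => [/kBorel_genP pB|]; last first.
  move=> pI; apply/kBorel_genP=> J JB uJ; case: (JB) => -[A Ak JA] _.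
  rewrite JA; apply: mon_ideal_msupp => m mp.
  have [a [ak /kBorel_genP/(_ _ JB uJ)]] := mon_ideal_coef pI mp.
  rewrite JA => aA am.
  have [//|b Ab ba] := mon_ideal_coef (m := a) aA; first by rewrite msuppX inE.
  exact: mon_idealX Ab (lepm_trans ba am).
apply: mon_ideal_msupp => m mp; pose a := [multinom minn (m i) k | i < n].
apply: (@mon_idealX _ a); last by apply/mnm_lepP=> i; rewrite mnmE geq_minl.
split; first by move=> i; rewrite mnmE geq_minr.
apply/kBorel_genP=> J JB uJ; case: (JB) => -[A Ak JA] _; rewrite JA.
have := pB _ JB uJ; rewrite JA => /mon_ideal_coef/(_ mp)[b Ab bm].
apply: (mon_idealX Ab); apply/mnm_lepP=> i.
by rewrite mnmE leq_min Ak // andbT; move/mnm_lepP: bm.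
Qed.

Lemma kBorel_gen_mem k u : 'X_[u] \in kBorel_gen k u.
Proof. by apply/kBorel_genP. Qed.

Lemma kBorel_gen_min k u J :
  kBorel k J -> 'X_[u] \in J -> {subset kBorel_gen k u <= J}.
Proof. by move=> JB uJ p /kBorel_genP; apply. Qed.

End MonomialIdeals.

Arguments kBorel_gen {n} K k u.

(* The monomial x_{i_1} ... x_{i_d} for s = [:: i_1; ...; i_d], with variables
   numbered from 1; an index outside 1..n contributes nothing.               *)
Definition xmon (n : nat) (s : seq nat) : 'X_{1..n} :=
  [multinom count_mem i.+1 s | i < n].

(* Main.v *)
From HB Require Import structures.
Require Import Defs.
From mathcomp Require Import all_boot all_order all_algebra mpoly.
From mathcomp Require Import finmap boolp zify ring.

(* Freiman's inequality [|2A| >= r |A| - C(r,2)], for a finite set A of exponent vectors of rank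
   r, is proved by adding the points of A in the order of an additive injective weight. When
   p is added, the q (p among them) for which p + q is not yet a sum of two points span
   A and p, so that at least r sums are new; hence the excess [|2A| - r |A| + C(r,2)] never
   decreases.

   For I = B_2(u) let A be the set of exponent vectors of G(I) and let m be the largest index
   of a variable dividing u. The rank of A is m, and so is the analytic spread. Upper bound:
   more than m elements of F(I) satisfy a polynomial relation, by counting monomials, and a
   strict chain of primes of length e would give e elements without any relation. Lower bound:
   a flag of faces of the Newton polytope gives a chain of m + 1 primes.

   If u is not one of the listed monomials, the part of A in the first four variables is one of
   finitely many sets, all of which have positive excess by computation, so A has positive
   excess. For the listed u the sums are enumerated, and the excess is 0. *)

Set Implicit Arguments.
Unset Strict Implicit.
Unset Printing Implicit Defensive.

Import GRing.Theory.

(** * Freiman's inequality for sets of exponent vectors *)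

Section Freiman.
Variable n : nat.
Implicit Types (A B : {fset 'X_{1..n}}) (a b p q : 'X_{1..n}).

Definition vec a : 'rV[rat]_n := (\row_i (a i)%:R)%R.

Lemma vecD a b : vec (a + b) = (vec a + vec b)%R.
Proof. by apply/rowP=> i; rewrite !mxE mnmDE natrD. Qed.

Definition sumset A : {fset 'X_{1..n}} := [fset (a + b)%MM | a in A, b in A]%fset.

Lemma sumsetP A c :
  reflect (exists a b, [/\ a \in A, b \in A & c = (a + b)%MM]) (c \in sumset A).
Proof.
apply: (iffP idP) => [/imfset2P[a /= aA [b /= bA ->]]|[a [b [aA bA ->]]]].
  by exists a, b.
by apply/imfset2P; exists a => //; exists b.
Qed.

Definition span_fset A : {vspace 'rV[rat]_n} := <<[seq vec a | a <- enum_fset A]>>%VS.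

Lemma mem_span_fset A a : a \in A -> vec a \in span_fset A.
Proof. by move=> aA; apply: memv_span; apply: map_f. Qed.

Lemma span_fset_le A (V : {vspace 'rV[rat]_n}) :
  (forall a, a \in A -> vec a \in V) -> (span_fset A <= V)%VS.
Proof. by move=> AV; apply/span_subvP=> _ /mapP[a aA ->]; apply: AV. Qed.

Lemma dim_span_fset A : \dim (span_fset A) <= #|` A|.
Proof. by apply: leq_trans (dim_span _) _; rewrite size_map. Qed.

Variable W : 'X_{1..n} -> nat.
Hypothesis WD : forall a b, W (a + b) = W a + W b.

(** The number d bounds the excess from below, which avoids subtraction. If p lies in the span of A,
    the rank stays r and at least r new sums p + q suffice. Otherwise the rank grows by one and p +
    q is new for every q in A and for q = p, which gives the |A| + 1 sums required. *)
Lemma freiman_step A p d :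
  (forall a, a \in A -> W a < W p) ->
  let r := \dim (span_fset A) in let r' := \dim (span_fset (p |` A)%fset) in
  r * #|` A| + d <= #|` sumset A| + 'C(r, 2) ->
  r' * #|` (p |` A)%fset| + d <= #|` sumset (p |` A)%fset| + 'C(r', 2).
Proof.
move=> pmax r r' leA.
have pA : p \notin A by apply/negP => /pmax; rewrite ltnn.
set B := (p |` A)%fset.
pose Q := [fset q in B | (p + q)%MM \notin sumset A]%fset.
have QB q : q \in Q = (q \in B) && ((p + q)%MM \notin sumset A) by rewrite !inE.
have leQB : (Q `<=` B)%fset by apply/fsubsetP=> q; rewrite QB => /andP[].
have pQ : p \in Q.
  rewrite QB fset1U1 /=; apply/sumsetP => -[a [b [/pmax aA /pmax bA /(congr1 W)]]].
  by rewrite !WD; lia.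
(* Induction on [W p - W q]: in p + q = a + b both a and b are lighter than p, hence heavier than q,
   and vec q = vec a + vec b - vec p. *)
have spanB q : q \in B -> vec q \in span_fset Q.
  have [k] := ubnP (W p - W q); elim: k q => // k IHk q kq qB.
  have [qQ|] := boolP (q \in Q); first exact: mem_span_fset.
  rewrite QB qB negbK => /sumsetP[a [b [aA bA pqab]]].
  have aB : a \in B by rewrite fset1Ur.
  have bB : b \in B by rewrite fset1Ur.
  have := congr1 W pqab; rewrite !WD => Wpq.
  have {}qA : W q < W p.
    move: qB pqab Wpq; rewrite in_fset1U => /predU1P[->|/pmax //] _.
    by have := pmax _ aA; have := pmax _ bA; lia.
  have va : vec a \in span_fset Q by apply: IHk => //; have := pmax _ bA; lia.
  have vb : vec b \in span_fset Q by apply: IHk => //; have := pmax _ aA; lia.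
  have := congr1 vec pqab; rewrite !vecD => /(canRL (addKr _)) ->.
  by rewrite memvD ?memvD // memvN mem_span_fset.
have leBQ : r' <= #|` Q|.
  by apply: leq_trans (dim_span_fset _); apply: dimvS; apply: span_fset_le.
have cardB : #|` B| = #|` A|.+1 by rewrite cardfsU1 pA.
have le2B : #|` sumset A| + #|` Q| <= #|` sumset B|.
  pose PQ := [fset (p + q)%MM | q in Q]%fset.
  have <- : #|` PQ| = #|` Q| by rewrite card_imfset //; apply: addmI.
  rewrite -(@cardfsUI _ (sumset A) PQ).
  have -> : (sumset A `&` PQ = fset0)%fset.
    apply/fsetP=> c; rewrite in_fsetI in_fset0; apply/negP => /andP[cA].
    by case/imfsetP=> q /=; rewrite QB => /andP[_ /negP qn] e; apply: qn; rewrite -e.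
  rewrite cardfs0 addn0; apply/fsubset_leq_card/fsubsetP=> c.
  rewrite in_fsetU => /orP[/sumsetP[a [b [aA bA ->]]]|/imfsetP[q /= qQ ->]].
    by apply/sumsetP; exists a, b; rewrite !fset1Ur.
  by apply/sumsetP; exists p, q; rewrite fset1U1 (fsubsetP leQB).
have [pS|pS] := boolP (vec p \in span_fset A).
  have -> : r' = r.
    apply/eqP; rewrite eqn_leq !dimvS //; apply: span_fset_le => a.
      by move=> aA; apply: mem_span_fset; rewrite fset1Ur.
    by rewrite in_fset1U => /predU1P[->|/mem_span_fset].
  suff : r <= #|` Q| by rewrite cardB; nia.
  apply: leq_trans leBQ; apply: dimvS; apply: span_fset_le => a aA.
  by apply: mem_span_fset; rewrite fset1Ur.
(* An equation p + q = a + b with q in A would put vec p into the span of A; with q = p it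
   contradicts the weights. *)
have QE : Q = B.
  apply/eqP; rewrite eqEfsubset leQB; apply/fsubsetP=> q qB; rewrite QB qB.
  apply: contra pS => /sumsetP[a [b [aA bA pqab]]].
  have [qA|qA] := boolP (q \in A).
    have := congr1 vec pqab; rewrite !vecD => /(canRL (addrK _)) ->.
    by rewrite memvD ?memvN ?memvD ?mem_span_fset.
  move: qB qA pqab; rewrite in_fset1U => /predU1P[->|-> //] _ /(congr1 W).
  by rewrite !WD; have := pmax _ aA; have := pmax _ bA; lia.
have r'r : r' <= r.+1.
  have le : (span_fset B <= span_fset A + <[vec p]>)%VS.
    apply: span_fset_le => a; rewrite in_fset1U => /predU1P[->|aA].
      by apply: (subvP (addvSr _ _)); apply: memv_line.
    by apply: (subvP (addvSl _ _)); apply: mem_span_fset.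
  apply: leq_trans (dimvS le) _.
  apply: leq_trans (dimv_add_leqif _ _) _.
  by rewrite -[in leqRHS]addn1 leq_add2l dim_vline leq_b1.
have rr' : r < r'.
  rewrite ltnNge; apply: contra pS => le.
  have le' : (span_fset A <= span_fset B)%VS.
    by apply: span_fset_le => a aA; apply: mem_span_fset; rewrite fset1Ur.
  have/eqP-> : (span_fset A == span_fset B)%VS by rewrite eqEdim le'.
  by apply: mem_span_fset; rewrite fset1U1.
have -> : r' = r.+1 by lia.
by move: le2B; rewrite QE cardB binS bin1; nia.
Qed.

(** Points are added one weight level at a time, and each level holds at most one point of A. The
    start c0 = 0 gives Freiman's inequality; a later start carries the excess of a small part over
    to all of A. *)
Lemma freiman_ind A c0 d :
  {in A &, injective W} ->
  let excess B := \dim (span_fset B) * #|` B| + d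
    <= #|` sumset B| + 'C(\dim (span_fset B), 2) in
  excess [fset a in A | W a < c0]%fset -> excess A.
Proof.
move=> Winj excess ex0.
have exc c : c0 <= c -> excess [fset a in A | W a < c]%fset.
  move/subnK <-; elim: (c - c0) => // k IHk; rewrite addSn; set c' := k + c0.
  have [/hasP[p pA /eqP Wp]|/hasPn noW] := boolP (has (fun a => W a == c') (enum_fset A)).
    have -> : [fset a in A | W a < c'.+1]%fset = (p |` [fset a in A | W a < c'])%fset.
      apply/fsetP=> a; rewrite in_fset1U !inE /= ltnS leq_eqVlt andb_orr.
      congr (_ || _); apply/andP/eqP => [[aA /eqP Wa]|->]; last by rewrite Wp.
      by apply: Winj => //; rewrite Wp.
    by apply: freiman_step => // a; rewrite !inE Wp => /andP[].
  suff -> : [fset a in A | W a < c'.+1]%fset = [fset a in A | W a < c']%fset by [].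
  apply/fsetP=> a; rewrite !inE /= ltnS leq_eqVlt.
  by case aA: (a \in A) => //=; rewrite (negbTE (noW _ aA)).
have := exc (maxn c0 (\max_(a <- enum_fset A) W a).+1) (leq_maxl _ _).
suff -> : [fset a in A | W a < maxn c0 (\max_(a <- enum_fset A) W a).+1]%fset = A by [].
apply/fsetP=> a; rewrite !inE /=; case aA: (a \in A) => //=.
by rewrite leq_max ltnS leq_bigmax_seq ?orbT.
Qed.

Lemma freiman_ineq A : {in A &, injective W} ->
  \dim (span_fset A) * #|` A| <= #|` sumset A| + 'C(\dim (span_fset A), 2).
Proof.
move=> Winj; have := @freiman_ind A 0 0 Winj; rewrite /= !addn0; apply.
have -> : [fset a in A | W a < 0]%fset = fset0 by apply/fsetP=> a; rewrite !inE andbF.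
by rewrite cardfs0 muln0.
Qed.

End Freiman.

(** Passing from r to r + 1 changes the bound r N - C(r, 2) by N - r, which is nonnegative as long
    as r is at most N. *)
Lemma freiman_bound_mono r s N : r <= s <= N -> r * N + 'C(s, 2) <= s * N + 'C(r, 2).
Proof.
case/andP=> /subnK <-; elim: (s - r) => [|k IHk] kN; first by rewrite leqnn.
have := IHk (ltnW kN); rewrite addSn binS bin1; nia.
Qed.

(** * Monomial ideals and Borel moves *)

Section MonIdeal.
Variables (n : nat) (K : fieldType).
Local Notation S := {mpoly K[n]}.
Implicit Types (I : {pred S}) (A : 'X_{1..n} -> Prop) (G : {fset 'X_{1..n}}).

Lemma mon_idealXP A m : 'X_[m] \in @mon_ideal n K A <-> exists2 a, A a & (a <= m)%MM.
Proof.
split=> [mA|[a]]; last exact: mon_idealX.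
by apply: mon_ideal_coef mA _; rewrite msuppX inE.
Qed.

Lemma mem_mon_ideal A a : A a -> 'X_[a] \in @mon_ideal n K A.
Proof. by move=> Aa; apply: mon_idealX Aa (lepm_refl _). Qed.

Lemma mon_ideal_sub A (A' : 'X_{1..n} -> Prop) :
  (forall a, A a -> exists2 a', A' a' & (a' <= a)%MM) ->
  {subset @mon_ideal n K A <= @mon_ideal n K A'}.
Proof.
move=> AA' p pA; apply: mon_ideal_msupp => m /(mon_ideal_coef pA)[a Aa am].
have [a' Aa' a'a] := AA' a Aa; exact: mon_idealX Aa' (lepm_trans a'a am).
Qed.

Lemma lepm_mdeg_eq (a b : 'X_{1..n}) : (a <= b)%MM -> mdeg a = mdeg b -> a = b.
Proof.
move=> ab /eqP; rewrite -{1}(submK ab) mdegD -{1}[mdeg a]add0n eqn_add2r eq_sym mdeg_eq0.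
by move=> /eqP ba; rewrite -(submK ab) ba add0m.
Qed.

(** Each a in G is divisible by some h in H, and h by some b in G; equal degrees force a = h = b. So
    G is contained in every set of monomial generators. *)
Lemma min_mon_gens_equigenerated I G H d :
  I =i @mon_ideal n K (fun m => m \in G) -> (forall a, a \in G -> mdeg a = d) ->
  min_mon_gens I H <-> H = G.
Proof.
move=> IG dG; split=> [[IH minH]|->]; last first.
  split=> // H' H'G IH'; apply/eqP; rewrite eqEfsubset H'G; apply/fsubsetP=> a aG.
  have : 'X_[a] \in I by rewrite IG; apply: mem_mon_ideal.
  rewrite IH' => /mon_idealXP[b bH' ba].
  by rewrite -(lepm_mdeg_eq ba) // !dG // (fsubsetP H'G).
symmetry; apply: minH => //; apply/fsubsetP=> a aG.
have : 'X_[a] \in I by rewrite IG; apply: mem_mon_ideal.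
rewrite IH => /mon_idealXP[h hH ha].
have : 'X_[h] \in I by rewrite IH; apply: mem_mon_ideal.
rewrite IG => /mon_idealXP[b bG bh].
have ab : b = a by apply: lepm_mdeg_eq (lepm_trans bh ha) _; rewrite !dG.
suff <- : h = a by [].
apply/mnmP=> i; apply/eqP; rewrite eqn_leq; move/mnm_lepP: ha => -> /=.
by move: bh; rewrite ab => /mnm_lepP.
Qed.

(** The k-fold sumset of A, with the summands listed so that single factors can be inspected in
    [ksum_tight]. *)
Definition ksum A k (m : 'X_{1..n}) : Prop :=
  exists s : seq 'X_{1..n}, [/\ size s = k, forall a, a \in s -> A a
    & m = (\sum_(a <- s) a)%MM].

Lemma ideal_exp_mon I A k : I =i @mon_ideal n K A ->
  ideal_exp I k =i @mon_ideal n K (ksum A k).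
Proof.
move=> IA; elim: k => [|k IHk] p.
  rewrite [LHS]/= inE; symmetry; apply: mon_ideal_msupp => m _.
  apply/mon_idealXP; exists 0%MM; first by exists [::]; rewrite big_nil.
  by apply/mnm_lepP=> i; rewrite mnm0E.
apply/idP/idP; move: p; apply: ideal_gen_ind.
- exact: ideal_gen0.
- exact: ideal_genD.
- exact: ideal_genM.
- move=> _ [f [g [fI gI ->]]]; apply: mon_ideal_msupp => m.
  move: fI gI; rewrite IA IHk => fI gI /msuppM_le/allpairsP[[m1 m2] /= [m1f m2g ->]].
  have [a Aa am1] := mon_ideal_coef fI m1f.
  have [b [s [sk sA bs]] bm2] := mon_ideal_coef gI m2g.
  apply/mon_idealXP; exists (a + b)%MM; last first.
    by apply/mnm_lepP=> i; rewrite !mnmDE leq_add //; apply/mnm_lepP.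
  exists (a :: s); rewrite big_cons /= sk bs; split=> // c.
  by rewrite inE => /predU1P[->//|/sA].
- exact: ideal_gen0.
- exact: ideal_genD.
- exact: ideal_genM.
move=> _ [_ [[|a s] [//= [sk] sA ->]] ->]; apply: ideal_gen_mem.
exists 'X_[a], 'X_[(\sum_(b <- s) b)%MM]; rewrite big_cons mpolyXD; split=> //.
  by rewrite IA; apply: mem_mon_ideal; apply: sA; apply: mem_head.
by rewrite IHk; apply: mem_mon_ideal; exists s; split=> // b bs; apply: sA; rewrite inE bs orbT.
Qed.

Lemma ideal_sqr_mon I G : I =i @mon_ideal n K (fun m => m \in G) ->
  ideal_exp I 2 =i @mon_ideal n K (fun m => m \in sumset G).
Proof.
move=> IG p; rewrite (ideal_exp_mon 2 IG); apply/idP/idP; apply: mon_ideal_sub => m.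
  move=> [[|a [|b [|c s]]] [//= _ sG ->]]; exists (a + b)%MM; last first.
    by rewrite !big_cons big_nil addm0 lepm_refl.
  by apply/sumsetP; exists a, b; rewrite !sG ?inE ?eqxx ?orbT.
move=> /sumsetP[a [b [aG bG ->]]]; exists (a + b)%MM; last exact: lepm_refl.
exists [:: a; b]; rewrite !big_cons big_nil addm0; split=> // c.
by rewrite !inE => /orP[]/eqP->.
Qed.

End MonIdeal.

(** * Tail degrees and the Borel order *)

Section Tail.
Variable n : nat.
Implicit Types (a b u v : 'X_{1..n}).

(** The degree in the variables of index at least t, counted from 0. Both the Borel moves and the
    faces used for the chain of primes are expressed through these numbers. *)
Definition tail t a := \sum_(i < n | t <= i) a i.

Lemma tail0 a : tail 0 a = mdeg a.
Proof. by rewrite mdegE. Qed.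

Lemma tailD t a b : tail t (a + b) = tail t a + tail t b.
Proof. by rewrite /tail -big_split; apply: eq_bigr => i _; rewrite mnmDE. Qed.

Lemma tail1 t (j : 'I_n) : tail t U_(j)%MM = (t <= j).
Proof.
rewrite /tail big_mkcond (bigD1 j) //= mnm1E eqxx big1 => [|i /negbTE ij].
  by case: ifP.
by rewrite mnm1E eq_sym ij if_same.
Qed.

Lemma tail_ord (i : 'I_n) a : tail i a = a i + tail i.+1 a.
Proof.
rewrite /tail (bigD1 i) //=; congr (_ + _); apply: eq_bigl => j.
by rewrite ltn_neqAle andbC eq_sym.
Qed.

Lemma tail_skip s r a : s <= r -> (forall i : 'I_n, s <= i < r -> a i = 0) ->
  tail s a = tail r a.
Proof.
move=> sr a0; rewrite /tail big_mkcond [RHS]big_mkcond; apply: eq_bigr => i _.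
case: (leqP r i) => [ri|ir]; first by rewrite (leq_trans sr ri).
by case: ifP => // si; rewrite a0 ?si.
Qed.

Lemma tail_le s r a : s <= r -> tail r a <= tail s a.
Proof.
move=> sr; rewrite /tail big_mkcond [leqRHS]big_mkcond; apply: leq_sum => i _.
by case: (leqP r i) => // /(leq_trans sr) ->.
Qed.

Lemma leq_tail t (i : 'I_n) a : t <= i -> a i <= tail t a.
Proof. by move=> ti; apply: leq_trans (tail_le _ ti); rewrite tail_ord leq_addr. Qed.

(** For k-bounded monomials this is reachability of a from u by Borel moves: a move never raises a
    tail, and [borel_le_step] gives the converse. *)
Definition borel_le u a :=
  mdeg a = mdeg u /\ forall t, tail t a <= tail t u.

Lemma move_mnmK u (i j : 'I_n) : 0 < u j ->
  (U_(i) + (u - U_(j)) + U_(j) = U_(i) + u)%MM.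
Proof. by move=> uj; rewrite -addmA submK // lep1mP -lt0n. Qed.

Lemma tail_move u (i j : 'I_n) t : 0 < u j ->
  tail t (U_(i) + (u - U_(j)))%MM + (t <= j) = (t <= i) + tail t u.
Proof. by move=> /(move_mnmK i)/(congr1 (tail t)); rewrite !tailD !tail1. Qed.

Lemma mdeg_move u (i j : 'I_n) : 0 < u j ->
  mdeg (U_(i) + (u - U_(j)))%MM = mdeg u.
Proof. by move=> uj; have := tail_move i 0 uj; rewrite !tail0; lia. Qed.

Lemma borel_le_move u a (i j : 'I_n) : 0 < a j -> i < j ->
  borel_le u a -> borel_le u (U_(i) + (a - U_(j)))%MM.
Proof.
move=> aj ij [da ta]; split=> [|t]; first by rewrite mdeg_move.
by have := tail_move i t aj; have := ta t; lia.
Qed.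

(* The move lowers the first variable of u after the first exponent where a and u differ. *)
Lemma borel_le_step k u a : kbounded k u -> kbounded k a -> borel_le u a -> a != u ->
  exists i j : 'I_n, [/\ 0 < u j, i < j, kbounded k (U_(i) + (u - U_(j)))%MM
    & borel_le (U_(i) + (u - U_(j)))%MM a].
Proof.
move=> uk ak [da ta] au.
have /existsP[s0 s0P] : [exists i, a i != u i].
  by apply: contraNT au => /existsPn E; apply/eqP/mnmP=> i; apply/eqP/negPn.
case: (@arg_minnP _ s0 (fun i => a i != u i) val s0P) => s sP smin.
have eqs (i : 'I_n) : i < s -> a i = u i.
  by move=> ils; apply/eqP/negPn/negP => /smin; rewrite leqNgt ils.
have tail_s : tail s a = tail s u.
  have split_tail b : mdeg b = \sum_(i < n | i < s) b i + tail s b.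
    rewrite mdegE (bigID (fun i : 'I_n => i < s)) /=; congr (_ + _).
    by apply: eq_bigl => i; rewrite -leqNgt.
  have := split_tail a; rewrite (eq_bigr u) ?da ?(split_tail u); first by move/addnI.
  by move=> i /eqs.
have uas : u s < a s by have := ta s.+1; move: tail_s (sP); rewrite !tail_ord; lia.
have tail_s1 : tail s.+1 a < tail s.+1 u by move: tail_s; rewrite !tail_ord; lia.
have /existsP[r0 r0P] : [exists r : 'I_n, (s < r) && (0 < u r)].
  apply: contraTT tail_s1 => /existsPn E; rewrite -leqNgt [tail _ u]big1 // => i si.
  by have := E i; rewrite si lt0n negbK => /eqP.
case: (@arg_minnP _ r0 (fun r : 'I_n => (s < r) && (0 < u r)) val r0P) => r /andP[sr ur] rmin.
have u0 (i : 'I_n) : s < i < r -> u i = 0.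
  case/andP=> si ir; apply/eqP; rewrite -leqn0 leqNgt; apply/negP => ui.
  by have := rmin i; rewrite si ui leqNgt ir => /(_ isT).
(* Variable r is replaced by its left neighbour, so only the tail at r drops. There is room for
   this: tail r u = tail s.+1 u > tail s.+1 a >= tail r a. *)
have r1n : r.-1 < n by apply: leq_ltn_trans (leq_pred _) (ltn_ord r).
pose i := Ordinal r1n.
have ir : i < r by rewrite /= prednK // (leq_trans _ sr).
have tail_r : tail s.+1 u = tail r u by apply: tail_skip.
exists i, r; split=> //; last first.
  split=> [|t]; first by rewrite mdeg_move.
  have := tail_move i t ur; have := ta t.
  have -> : (t <= i) = (t < r) by apply/idP/idP => /=; lia.
  by case: (ltngtP t r) => [_|_|->]; have := tail_le a sr; lia.
(* The bound could fail only at i. If i = s, then u s < a s <= k; otherwise u i = 0, and k is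
   positive because a s is. *)
move=> l; rewrite mnmDE mnmBE !mnm1E.
have [<-|il] := eqVneq i l; last by apply: leq_trans (leq_subr _ _) (uk l).
have -> : r == i = false by apply/eqP => /(congr1 val) /=; lia.
rewrite subn0; have [is_|is_] := eqVneq i s.
  by rewrite is_; apply: leq_trans (ak s); lia.
have -> : u i = 0; last by have := ak s; lia.
by apply: u0; rewrite ir andbT ltn_neqAle eq_sym is_ /=; lia.
Qed.

End Tail.

(** * Generators of a principal k-Borel ideal *)

Section BorelGens.
Variables (n : nat) (K : fieldType).
Implicit Types (u a : 'X_{1..n}).

(** The right hand side is k-Borel because a move on a multiple of v yields a multiple of v or of
    the moved v. Conversely, [borel_le_step] leads from u to each a below it by moves, which stay in
    any k-Borel ideal containing u. *)
Lemma kBorel_genE k u : kbounded k u ->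
  kBorel_gen K k u =i @mon_ideal n K (fun a => kbounded k a /\ borel_le u a).
Proof.
move=> uk; set B := fun a => _; have Bu : B u by split=> //; split.
have monB : kBorel k (@mon_ideal n K B).
  split; first by exists B => // m [].
  move=> w i j wk /mon_idealXP[v [vk uv] vw] wj ij wk'.
  apply/mon_idealXP; have [vjw|] := ltnP (v j) (w j).
    exists v => //; apply/mnm_lepP=> l; move/mnm_lepP/(_ l): vw.
    rewrite mnmDE mnmBE !mnm1E; have [<-|] := eqVneq j l; last by lia.
    by move=> _; rewrite -addn1 in vjw; apply: leq_trans (leq_addl _ _); lia.
  move=> wvj; have vj : 0 < v j by apply: leq_trans wvj.
  have le : (U_(i) + (v - U_(j)) <= U_(i) + (w - U_(j)))%MM.
    by apply/mnm_lepP=> l; move/mnm_lepP/(_ l): vw; rewrite !mnmDE !mnmBE; lia.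
  exists (U_(i) + (v - U_(j)))%MM => //; split; last exact: borel_le_move.
  by move=> l; apply: leq_trans (wk' l); move/mnm_lepP: le.
move=> p; apply/idP/idP.
  by apply: kBorel_gen_min => //; apply: mem_mon_ideal.
move=> pB; apply/kBorel_genP=> J JB uJ; case: (JB) => -[C Ck JC] Jmove.
suff BC a : B a -> 'X_[a] \in J.
  by rewrite JC; apply: mon_ideal_sub pB => a /BC; rewrite JC => /mon_idealXP.
case=> ak ua.
(* Each move lowers the sum of all tails of u, since the tail at j drops and none rises. *)
have [N] := ubnP (\sum_(t < n) tail t u).
elim: N u uk {B Bu monB pB} uJ ua => // N IHN u uk uJ ua uN.
have [-> //|au] := eqVneq a u.
have [i [j [uj ij uk' ua']]] := borel_le_step uk ak ua au.
apply: (IHN _ uk') => //; first exact: Jmove.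
rewrite -ltnS; apply: leq_trans uN; rewrite ltnS.
rewrite (bigD1 j) // [leqRHS](bigD1 j) //= -addSn; apply: leq_add.
  by have := tail_move i j uj; rewrite leqnn; lia.
by apply: leq_sum => t _; have := tail_move i t uj; lia.
Qed.

(** The monomials of degree at most that of u form a finite type, which makes this a finite set. *)
Definition borel_gens k u : {fset 'X_{1..n}} :=
  [fset val b | b : 'X_{1..n < (mdeg u).+1} & `[< kbounded k (val b) /\ borel_le u (val b) >]]%fset.

Lemma borel_gensP k u a : reflect (kbounded k a /\ borel_le u a) (a \in borel_gens k u).
Proof.
apply: (iffP idP) => [/imfsetP[b /= + ->]|au].
  by rewrite inE => /asboolP.
have da : mdeg a < (mdeg u).+1 by case: au => _ [->].
apply/imfsetP; exists (BMultinom da) => //=; rewrite inE; exact/asboolP.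
Qed.

Lemma kBorel_gen_mon k u : kbounded k u ->
  kBorel_gen K k u =i @mon_ideal n K (fun a => a \in borel_gens k u).
Proof.
move=> uk p; rewrite kBorel_genE //.
apply/idP/idP; apply: mon_ideal_sub => a aP; exists a; rewrite ?lepm_refl //.
  exact/borel_gensP.
exact/borel_gensP.
Qed.

End BorelGens.

(** * Krull dimension of the fiber ring *)

Local Open Scope ring_scope.

(** * Initial forms on the Rees algebra *)

Section HomogeneousPart.
Variables (n : nat) (K : fieldType) (mf : measure n).
Implicit Types p q : {mpoly K[n]}.

Lemma mcoeff_pihomog d p m : (pihomog mf d p)@_m = p@_m *+ (mf m == d).
Proof.
rewrite pihomogE raddf_sum /=.
under eq_bigr do rewrite mcoeffZ mcoeffX.
rewrite -big_filter; set s := filter _ _.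
have us : uniq s by rewrite filter_uniq ?msupp_uniq.
have [ms|ms] := boolP (m \in s).
  rewrite (bigD1_seq m) //= eqxx mulr1 big1 ?addr0 => [|m' /negbTE->]; last by rewrite mulr0.
  by move: ms; rewrite mem_filter => /andP[->].
rewrite big_seq big1 => [|m' m's]; last first.
  by case: eqP => [e|_]; [rewrite -e m's in ms|rewrite mulr0].
move: ms; rewrite mem_filter; case: (mf m == d); rewrite //=.
by move/memN_msupp_eq0->.
Qed.

Definition supp_ge d p := forall m, m \in msupp p -> (d <= mf m)%N.

Lemma supp_ge_coef d p m : supp_ge d p -> p@_m != 0 -> (d <= mf m)%N.
Proof. by move=> pd; rewrite -mcoeff_msupp => /pd. Qed.

(** In the lowest possible weight d + e, only products of terms of weight exactly d and e
    contribute. *)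
Lemma pihomogM d e p q : supp_ge d p -> supp_ge e q ->
  pihomog mf (d + e) (p * q) = pihomog mf d p * pihomog mf e q.
Proof.
move=> pd qe; apply/mpolyP=> m; rewrite mcoeff_pihomog !mcoeffM -sumrMnl.
apply: eq_bigr => -[k1 k2] /= /eqP mE; rewrite !mcoeff_pihomog.
rewrite [mf m](_ : _ = (mf k1 + mf k2)%N); last by rewrite -mfD -mE.
have [->|/(supp_ge_coef pd) le1] := eqVneq p@_k1 0; first by rewrite !(mul0r, mul0rn).
have [->|/(supp_ge_coef qe) le2] := eqVneq q@_k2 0; first by rewrite !(mulr0, mul0rn).
have -> : (mf k1 + mf k2 == d + e)%N = (mf k1 == d) && (mf k2 == e).
  by apply/eqP/andP => [E|[/eqP-> /eqP->]]; rewrite // -!(rwP eqP); lia.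
by case: (mf k1 == d); case: (mf k2 == e); rewrite ?(mulr0n, mul0r, mulr0).
Qed.

End HomogeneousPart.

Section InitialForm.
Variables (n : nat) (K : fieldType) (A : 'X_{1..n} -> Prop) (I : {pred {mpoly K[n]}}).
Hypothesis IA : I =i @mon_ideal n K A.
Variables (mf : measure n) (c : nat).
Hypothesis Ac : forall a, A a -> (c <= mf a)%N.

Lemma mf_le a b : (a <= b)%MM -> (mf a <= mf b)%N.
Proof. by move/submK => <-; rewrite mfD leq_addl. Qed.

Lemma mf_ksum k m : ksum A k m -> (c * k <= mf m)%N.
Proof.
case=> s [<- sA ->]; elim: s sA => [|a s IHs] sA; first by rewrite muln0.
rewrite big_cons mfD mulnS leq_add ?IHs // => [|b bs].
  by apply/Ac/sA; rewrite mem_head.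
by apply: sA; rewrite inE bs orbT.
Qed.

Lemma supp_ge_exp k p : p \in ideal_exp I k -> supp_ge mf (c * k) p.
Proof.
rewrite (ideal_exp_mon k IA) => pk m /(mon_ideal_coef pk)[a /mf_ksum ka /mf_le].
exact: leq_trans.
Qed.

(* The part of f supported on the face [mf = c] of the cone of the Rees algebra; for mf = mdeg
   and an ideal generated in degree c its kernel is the ideal defining the fiber ring. *)
Definition initial_form (f : rees I) : {poly {mpoly K[n]}} :=
  \poly_(k < size (val f)) pihomog mf (c * k) (val f)`_k.

Lemma coef_initial_form f k : (initial_form f)`_k = pihomog mf (c * k) (val f)`_k.
Proof.
rewrite coef_poly; case: ltnP => // sk.
by rewrite nth_default // pihomog0.
Qed.

Lemma initial_formB : zmod_morphism initial_form.
Proof.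
by move=> f g; apply/polyP=> k; rewrite coefB !coef_initial_form coefB pihomogB.
Qed.

(** Elements of I^k have weight at least c k, so [pihomogM] applies to every product of
    coefficients. *)
Lemma initial_formM : monoid_morphism initial_form.
Proof.
split=> [|f g]; apply/polyP=> k; rewrite coef_initial_form.
  have -> : val (1 : rees I) = 1 by [].
  rewrite coef1; apply/mpolyP=> m; rewrite mcoeff_pihomog.
  case: (k == 0%N) / eqP => [->|_]; rewrite ?mcoeff0 ?mul0rn // mcoeff1 muln0.
  by have [->|_] := eqVneq m 0%MM; rewrite ?mul0rn // mf0 eqxx.
rewrite coefM [val (f * g)]/= coefM raddf_sum /=; apply: eq_bigr => i _.
rewrite !coef_initial_form -pihomogM; last 2 first.
- by apply: supp_ge_exp; apply/rees_predP; case: f.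
- by apply: supp_ge_exp; apply/rees_predP; case: g.
by rewrite -mulnDr subnKC // -ltnS.
Qed.

End InitialForm.

(** * Relations along a chain of primes *)

Section PrimeChainRelation.
Variables (R : comNzRingType) (e : nat) (Q : nat -> prime_idealr R) (x : nat -> R).
Hypothesis QS : forall i, (i < e)%N -> {subset (Q i : {pred R}) <= (Q i.+1 : {pred R})}.
Hypothesis xQ : forall i, (i < e)%N ->
  x i \in (Q i.+1 : {pred R}) /\ x i \notin (Q i : {pred R}).

Lemma prime_idealrX (P : prime_idealr R) y k :
  y \notin (P : {pred R}) -> y ^+ k \notin (P : {pred R}).
Proof.
move=> yP; elim: k => [|k IHk]; first by rewrite expr0 idealr1.
by rewrite exprS prime_idealrM negb_or yP.
Qed.

(* Walking up the chain, the terms of least x_i-degree are factored out at step i: they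
   form a shorter relation modulo the next prime, until a single coefficient is left. *)
Lemma prime_chain_relation (J : finType) (E : J -> nat -> nat) (c : J -> R) :
  (forall f g, (forall i, (i < e)%N -> E f i = E g i) -> f = g) ->
  (forall f, c f != 0 -> c f \notin (Q e : {pred R})) ->
  \sum_f c f * \prod_(0 <= i < e) x i ^+ E f i \in (Q 0%N : {pred R}) ->
  forall f, c f = 0.
Proof.
move=> Einj cQ rel f0; apply/eqP/negPn/negP => cf0.
(* T is the set of terms left at step i: they share their exponents in x 0, ..., x (i - 1), and
   these powers have been cancelled. *)
suff Step i : (i <= e)%N -> exists T : {set J}, [/\ T != set0,
    {in T, forall f, c f != 0},
    {in T &, forall f g j, (j < i)%N -> E f j = E g j}
  & \sum_(f in T) c f * \prod_(i <= j < e) x j ^+ E f j \in (Q i : {pred R})].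
  have [T [/set0Pn[f fT] Tc TE]] := Step e (leqnn e).
  have -> : T = [set f].
    apply/setP=> g; rewrite inE; apply/idP/eqP => [gT|-> //].
    by apply: Einj => i; apply: TE.
  by rewrite big_set1 big_geq // mulr1 (negbTE (cQ f (Tc f fT))).
elim: i => [_|i IHi ie].
  exists [set f | c f != 0]; split=> //.
  - by apply/set0Pn; exists f0; rewrite inE.
  - by move=> f; rewrite inE.
  move: rel; rewrite (bigID (fun f => c f != 0)) /= [X in _ + X]big1 => [|f].
    by rewrite addr0 (eq_bigl (mem [set f | c f != 0])) // => f; rewrite !inE.
  by move/negPn/eqP->; rewrite mul0r.
have [T [/set0Pn[g0 g0T] Tc TE rT]] := IHi (ltnW ie).
case: (@arg_minnP _ g0 (fun f => f \in T) (fun f => E f i) g0T) => g gT gmin.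
have [xS xN] := xQ ie.
pose T' := [set f in T | E f i == E g i].
exists T'; split.
- by apply/set0Pn; exists g; rewrite inE gT eqxx.
- by move=> f; rewrite inE => /andP[/Tc].
- move=> f f'; rewrite !inE => /andP[fT /eqP fE] /andP[f'T /eqP f'E] j.
  by rewrite ltnS leq_eqVlt => /predU1P[->|]; [rewrite fE f'E|apply: TE].
(* The terms outside T' contain a higher power of x i. After x i ^+ E g i is cancelled modulo Q i,
   they keep a factor x i in Q i.+1, so the sum over T' lies there as well. *)
pose y := \sum_(f in T | E f i != E g i)
  c f * (x i ^+ (E f i - E g i).-1 * \prod_(i.+1 <= j < e) x j ^+ E f j).
move: rT; set s' := \sum_(f in T') _.
have -> : \sum_(f in T) c f * \prod_(i <= j < e) x j ^+ E f j
        = x i ^+ E g i * (s' + x i * y).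
  rewrite (bigID (fun f => E f i == E g i)) /= mulrDr; congr (_ + _).
    rewrite mulr_sumr; apply: eq_big => [f|f /andP[_ /eqP fE]]; first by rewrite !inE.
    by rewrite big_ltn // fE mulrCA.
  rewrite !mulr_sumr; apply: eq_bigr => f /andP[fT fE].
  rewrite big_ltn //; set k := _.-1; set z := \prod_(_ <= _ < _) _.
  have -> : E f i = ((E g i).+1 + k)%N by have := gmin f fT; move: fE; rewrite /k; lia.
  by rewrite exprD exprS; ring.
rewrite prime_idealrM (negbTE (prime_idealrX _ xN)) /= => /(QS ie) sQ.
by rewrite -[s'](addrK (x i * y)) rpredB // mulrC idealMr.
Qed.

End PrimeChainRelation.

(** * The initial form morphism and the fiber ring *)

Section InitialMorphism.
Variables (n : nat) (K : fieldType) (A : 'X_{1..n} -> Prop) (I : {pred {mpoly K[n]}}).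
Variables (mf : measure n) (c : nat).

(** The two proofs are arguments so that the ring morphism structure, which depends on them, can be
    inferred from the term. *)
Definition initial_morph of I =i @mon_ideal n K A & (forall a, A a -> (c <= mf a)%N) :=
  @initial_form n K I mf c.

Variables (IA : I =i @mon_ideal n K A) (Ac : forall a, A a -> (c <= mf a)%N).

HB.instance Definition _ := GRing.isZmodMorphism.Build _ _ (initial_morph IA Ac)
  (@initial_formB n K I mf c).
HB.instance Definition _ := GRing.isMonoidMorphism.Build _ _ (initial_morph IA Ac)
  (initial_formM IA Ac).

Lemma supp_ge0 d : supp_ge mf d (0 : {mpoly K[n]}).
Proof. by move=> m; rewrite msupp0. Qed.

Lemma supp_geD d p q : supp_ge mf d p -> supp_ge mf d q -> @supp_ge n K mf d (p + q).
Proof. by move=> pd qd m /msuppD_le; rewrite mem_cat => /orP[/pd|/qd]. Qed.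

Lemma supp_geM d e p q : supp_ge mf d p -> supp_ge mf e q -> @supp_ge n K mf (d + e) (p * q).
Proof.
move=> pd qe m /msuppM_le/allpairsP[[m1 m2] /= [/pd le1 /qe le2 ->]].
by rewrite mfD leq_add.
Qed.

Lemma supp_geMl d a p : supp_ge mf d p -> @supp_ge n K mf d (a * p).
Proof. by move=> pd; rewrite -[d]add0n; apply: supp_geM. Qed.

Lemma supp_ge_gen d (B : {mpoly K[n]} -> Prop) : (forall p, B p -> supp_ge mf d p) ->
  forall p, p \in ideal_gen B -> supp_ge mf d p.
Proof.
move=> Bd; apply: ideal_gen_ind => //.
- exact: supp_ge0.
- exact: supp_geD.
- by move=> a p; apply: supp_geMl.
Qed.

Hypothesis mf_gt0 : forall i, (0 < mf U_(i)%MM)%N.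

(** Elements of m I^k have weight at least 1 + c k, so their part of weight c k is zero. The
    morphism therefore factors through the fiber ring. *)
Lemma rees_max_initial f : f \in @rees_max n K I -> initial_morph IA Ac f = 0.
Proof.
move=> /rees_maxP fm; apply/polyP=> k; rewrite coef_initial_form coef0.
have fk : supp_ge mf (1 + c * k) (val f)`_k.
  move: (fm k); apply: supp_ge_gen => _ [a [b [am bI ->]]].
  apply: supp_geM; last by apply: (supp_ge_exp IA Ac bI).
  apply: supp_ge_gen am => _ [i ->] m; rewrite msuppX inE => /eqP->.
  exact: mf_gt0.
apply/mpolyP=> m; rewrite mcoeff_pihomog mcoeff0.
have [->|/(supp_ge_coef fk)] := eqVneq ((val f)`_k@_m) 0; first by rewrite mul0rn.
by case: eqP => // ->; lia.
Qed.

End InitialMorphism.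

Section ReesConst.
Variables (n : nat) (K : fieldType) (I : {pred {mpoly K[n]}}).

Lemma rees_const_subproof (a : K) : (a%:MP)%:P \in rees_pred I.
Proof. by apply/rees_predP => -[|k] //; rewrite coefC; exact: ideal_exp0. Qed.

Definition rees_const a : rees I := Rees (rees_const_subproof a).

Lemma rees_constM a b : rees_const (a * b) = rees_const a * rees_const b.
Proof. by apply/val_inj; rewrite /= mpolyCM polyCM. Qed.

Lemma rees_const1 : rees_const 1 = 1.
Proof. exact/val_inj. Qed.

Lemma rees_const0 : rees_const 0 = 0.
Proof. by apply/val_inj; rewrite /= mpolyC0 polyC0. Qed.

Local Notation F := (fiber_ring I).
Local Notation pi := (\pi_({ideal_quot (@rees_max n K I)})%qT : rees I -> F).

(** Nonzero constants are units. *)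
Lemma fiber_const_prime (P : prime_idealr F) a : a != 0 ->
  pi (rees_const a) \notin (P : {pred F}).
Proof.
move=> a0; apply/negP => aP.
have : pi 1 \in (P : {pred F}).
  rewrite -rees_const1 -(mulVf a0) rees_constM rmorphM.
  exact: idealMr.
by rewrite rmorph1 idealr1.
Qed.

Lemma fiber_pi0 f : (pi f == 0) = (f \in @rees_max n K I).
Proof. by rewrite -(rmorph0 pi) -Quotient.idealrBE subr0. Qed.

End ReesConst.

Lemma size_prod_pred (R : comNzRingType) (J : Type) (r : seq J) (F : J -> {poly R}) (s : nat) :
  (forall j, (size (F j)).-1 <= s)%N -> ((size (\prod_(j <- r) F j)%R).-1 <= size r * s)%N.
Proof.
move=> Fs; elim: r => [|j r IHr]; first by rewrite big_nil size_poly1.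
rewrite big_cons; move: IHr (Fs j); set P := \prod_(i <- r) F i.
have := size_polyMleq (F j) P; rewrite /= mulSn.
by move: (size P) (size (F j * P)) (size (F j)) => a b c; lia.
Qed.

Lemma size_exp_pred (R : comNzRingType) (p : {poly R}) k :
  ((size (p ^+ k)%R).-1 <= (size p).-1 * k)%N.
Proof. by have := size_poly_exp_leq p k; case: (size (p ^+ k)). Qed.

Lemma row_kernel (K : fieldType) (X Y : finType) (B : X -> Y -> K) : (#|Y| < #|X|)%N ->
  exists2 v : X -> K, exists x, v x != 0 & forall y, \sum_x v x * B x y = 0.
Proof.
move=> YX; pose M : 'M[K]_(#|X|, #|Y|) := \matrix_(i, j) B (enum_val i) (enum_val j).
have /rowV0Pn[v /sub_kermxP vM v0] : kermx M != 0.
  by rewrite -mxrank_eq0 mxrank_ker subn_eq0 -ltnNge (leq_ltn_trans (rank_leq_col M)).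
exists (fun x => v 0 (enum_rank x)) => [|y].
  have [i vi] : exists i, v 0 i != 0.
    apply: contrapT => nv; case/eqP: v0; apply/rowP=> i; rewrite mxE.
    by apply: contrapT => /eqP vi; apply: nv; exists i.
  by exists (enum_val i); rewrite enum_valK.
have /rowP/(_ (enum_rank y)) := vM; rewrite !mxE => E; rewrite -[RHS]E.
rewrite [RHS](reindex (@enum_rank X)) /=; last by apply: onW_bij; apply: enum_rank_bij.
by apply: eq_bigr => i _; rewrite !mxE !enum_rankK.
Qed.

(** * Upper bound for the Krull dimension *)

Section KrullUpperBound.
Variables (n : nat) (K : fieldType) (G : {fset 'X_{1..n}}) (I : {pred {mpoly K[n]}}).
Hypothesis IG : I =i @mon_ideal n K (fun m => m \in G).
Variables (d : nat) (D : {set 'I_n}).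
Hypothesis d_gt0 : (0 < d)%N.
Hypothesis Gd : forall a, a \in G -> mdeg a = d.
Hypothesis GD : forall a (i : 'I_n), a \in G -> (0 < a i)%N -> i \in D.

Local Notation F := (fiber_ring I).
Local Notation pi := (\pi_({ideal_quot (@rees_max n K I)})%qT : rees I -> F).

Let Gd_le a : a \in G -> (d <= mdeg a)%N. Proof. by move/Gd->. Qed.
Local Notation psi := (initial_morph IG (mf := mdeg) Gd_le).

Lemma ksum_mdeg k m : ksum (fun m => m \in G) k m -> mdeg m = (d * k)%N.
Proof.
case=> s [<- sG ->]; elim: s sG => [|a s IHs] sG; first by rewrite big_nil mdeg0 muln0.
rewrite big_cons mdegD mulnS Gd ?IHs // ?sG ?mem_head // => b bs.
by rewrite sG // inE bs orbT.
Qed.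

Lemma ksum_supp k m (i : 'I_n) : ksum (fun m => m \in G) k m -> (0 < m i)%N -> i \in D.
Proof.
case=> s [_ sG ->]; elim: s sG => [|a s IHs] sG; first by rewrite big_nil mnm0E.
rewrite big_cons mnmDE addn_gt0 => /orP[|]; first by apply: GD; rewrite sG ?mem_head.
by apply: IHs => b bs; rewrite sG // inE bs orbT.
Qed.

(** A monomial of degree d k in I^k is divisible by a product of k generators, which has the same
    degree and so equals it. *)
Lemma coef_psi_supp (f : rees I) k m : (psi f)`_k@_m != 0 ->
  ksum (fun m => m \in G) k m.
Proof.
rewrite coef_initial_form mcoeff_pihomog.
have [md|_] := eqVneq (mdeg m) (d * k)%N; last by rewrite eqxx.
rewrite mulr1n -mcoeff_msupp => ms.
have fk : (val f)`_k \in ideal_exp I k by apply/rees_predP; case: f {ms}.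
move: (fk); rewrite (ideal_exp_mon k IG) => /mon_ideal_coef/(_ ms)[a ka am].
by rewrite -(lepm_mdeg_eq am) // md (ksum_mdeg ka).
Qed.

(** If the part of degree d k vanishes, each monomial of the k-th coefficient is a proper multiple
    of a product of k generators, so it lies in m I^k. Together with [rees_max_initial] this embeds
    the fiber ring into S[t]. *)
Lemma initial_ker_rees_max f : psi f = 0 -> f \in @rees_max n K I.
Proof.
move=> f0; apply/rees_maxP=> k.
have fk : (val f)`_k \in ideal_exp I k by apply/rees_predP; case: f {f0}.
rewrite [(val f)`_k]mpolyE big_seq; apply: ideal_gen_sum => m ms.
rewrite -mul_mpolyC; apply: ideal_genM.
move: (fk); rewrite (ideal_exp_mon k IG) => /mon_ideal_coef/(_ ms)[a ka am].
rewrite -(submK am) mpolyXD; apply: ideal_gen_mem.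
exists 'X_[(m - a)%MM], 'X_[a]; split=> //; last first.
  by rewrite (ideal_exp_mon k IG); apply: mem_mon_ideal.
have : (m - a)%MM != 0%MM.
  apply/eqP => ma; have E : m = a by rewrite -(submK am) ma add0m.
  have /mpolyP/(_ m) : (psi f)`_k = 0 by rewrite f0 coef0.
  rewrite coef_initial_form mcoeff_pihomog mcoeff0 E /= (ksum_mdeg ka) eqxx -E.
  by apply/eqP; rewrite -mcoeff_msupp.
move: (m - a)%MM => b b0.
have [i bi] : exists i, b i != 0%N.
  apply: contrapT => nb; case/eqP: b0; apply/mnmP=> i; rewrite mnm0E.
  by apply: contrapT => /eqP bi; apply: nb; exists i.
have ib : (U_(i) <= b)%MM by rewrite lep1mP.
rewrite -(submK ib) mpolyXD; apply: ideal_genM; apply: ideal_gen_mem.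
by exists i.
Qed.

(** There are N^e products of powers of the x i with exponents below N, while their initial forms
    involve at most (C N)^|D| monomials, with C independent of N. For e > |D| and N > C^|D| the
    products are more numerous, so linear algebra yields a relation. *)
Lemma fiber_relation e (x : nat -> rees I) : (#|D| < e)%N ->
  exists N (v : {ffun 'I_e -> 'I_N} -> K), (exists f, v f != 0) /\
   \sum_f rees_const I (v f) * \prod_(i < e) x i ^+ f i \in @rees_max n K I.
Proof.
move=> De; pose s := (\max_(i < e) (size (psi (x i))).-1)%N.
(* The initial forms of the x i have t-degree at most s, so those of the products have t-degree at
   most e s N and monomials of degree at most d e s N, which is below M. *)
pose C := (d * (e * s)).+1; pose N := (C ^ #|D|).+1; pose M := (C * N)%N.
pose T := {i : 'I_n | i \in D}.
pose mon (g : {ffun T -> 'I_M}) : 'X_{1..n} :=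
  [multinom (if insub i is Some t then val (g t) else 0%N) | i < n].
pose Y (f : {ffun 'I_e -> 'I_N}) := \prod_(i < e) x i ^+ f i.
have cardlt : (#|{ffun T -> 'I_M}| < #|{ffun 'I_e -> 'I_N}|)%N.
  rewrite !card_ffun !card_ord card_sig.
  have -> : #|[pred i | i \in D]| = #|D| by apply: eq_card.
  apply: (@leq_trans (N ^ #|D|.+1)); last by rewrite leq_pexp2l.
  by rewrite expnMn expnS ltn_mul2r expn_gt0 /= leqnn.
(* The power of t that goes with a monomial is its degree divided by d, so the monomials alone index
   the equations. *)
have [v vn0 vB] := @row_kernel K _ _
  (fun f g => (psi (Y f))`_(mdeg (mon g) %/ d)@_(mon g)) cardlt.
exists N, v; split=> //; apply: initial_ker_rees_max.
apply/polyP=> k; apply/mpolyP=> m; rewrite coef0 mcoeff0.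
rewrite rmorph_sum coef_sum raddf_sum /=.
have coefE f : (psi (rees_const I (v f) * Y f))`_k@_m = v f * (psi (Y f))`_k@_m.
  rewrite rmorphM /= [psi (rees_const _ _)](_ : _ = ((v f)%:MP)%:P).
    by rewrite coefCM mcoeffCM.
  apply/polyP=> j; rewrite coef_initial_form.
  have -> : val (rees_const I (v f)) = ((v f)%:MP)%:P by [].
  rewrite coefC; apply/mpolyP=> m'; rewrite mcoeff_pihomog; case: (j =P 0%N) => [->|];
    last by rewrite mcoeff0 mul0rn.
  rewrite mcoeffC muln0; have [->|_] := eqVneq m' 0%MM; last by rewrite !mulr0 mul0rn.
  by rewrite mf0.
under eq_bigr do rewrite coefE.
have [[f0 f0m]|nof] := pselect (exists f, (psi (Y f))`_k@_m != 0); last first.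
  rewrite big1 // => f _; have [->|fm] := eqVneq ((psi (Y f))`_k@_m) 0; first by rewrite mulr0.
  by case: nof; exists f.
have km := coef_psi_supp f0m; have md := ksum_mdeg km.
have mM i : (m i < M)%N.
  have le1 : (m i <= mdeg m)%N by rewrite mdegE (bigD1 i) //= leq_addr.
  have le2 : (k <= (size (psi (Y f0))).-1)%N.
    rewrite -ltnS; apply: leq_trans (leqSpred _); rewrite ltnNge.
    by apply: contra f0m => /(nth_default 0) ->; rewrite mcoeff0.
  have le3 : ((size (psi (Y f0))).-1 <= e * (s * N))%N.
    rewrite rmorph_prod -[in leqRHS](card_ord e) cardE enumT; apply: size_prod_pred => i'.
    rewrite rmorphXn; apply: leq_trans (size_exp_pred _ _) _.
    apply: leq_mul; last exact/ltnW.
    exact: (leq_bigmax i').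
  apply: leq_ltn_trans le1 _; rewrite md /M /C.
  apply: (@leq_ltn_trans (d * (e * (s * N)))%N);
    first by rewrite leq_mul2l (leq_trans le2) ?orbT.
  by rewrite mulSn !mulnA -[ltnLHS]add0n ltn_add2r.
pose g : {ffun T -> 'I_M} := [ffun t : T => Ordinal (mM (val t))].
have mg : mon g = m.
  apply/mnmP=> i; rewrite mnmE; case: insubP => [t _ ti|iD]; first by rewrite ffunE /= ti.
  by apply/esym/eqP; rewrite -leqn0 leqNgt; apply: contra iD => /(ksum_supp km).
by have := vB g; rewrite mg md mulKn.
Qed.

Lemma krull_dim_le e : prime_chain F e -> (e <= #|D|)%N.
Proof.
case=> P PS; rewrite leqNgt; apply/negP => De.
pose Q i := P (inord i).
have QS i : (i < e)%N -> {subset (Q i : {pred F}) <= (Q i.+1 : {pred F})} /\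
    ~ {subset (Q i.+1 : {pred F}) <= (Q i : {pred F})}.
  by move=> ie; apply: PS; rewrite !inordK // ltnS ltnW.
have xex i : exists y : F, (i < e)%N ->
    y \in (Q i.+1 : {pred F}) /\ y \notin (Q i : {pred F}).
  have [ie|_] := boolP (i < e)%N; last by exists 0.
  have [_ nS] := QS i ie; apply: contrapT => nx; apply: nS => y yQ.
  by apply: contrapT => /negP ynQ; apply: nx; exists y.
have [x xP] := choice xex.
have [N [v [[f vf] rel]]] := fiber_relation (fun i => repr (x i)) De.
pose E (f : {ffun 'I_e -> 'I_N}) i := if insub i is Some j then val (f j) else 0%N.
have EE f' (i : 'I_e) : E f' i = f' i by rewrite /E valK.
have /(_ f)/eqP : forall f, pi (rees_const I (v f)) = 0.
  apply: (prime_chain_relation (fun i ie => (QS i ie).1) xP (E := E)).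
  - by move=> f1 f2 f12; apply/ffunP=> i; apply/val_inj; rewrite /= -!EE f12.
  - move=> f'; have [->|vf' _] := eqVneq (v f') 0; first by rewrite rees_const0 rmorph0 eqxx.
    exact: fiber_const_prime.
  move: rel; rewrite -fiber_pi0 rmorph_sum /= => /eqP rel.
  rewrite (_ : \sum_f' _ = 0) ?idealr0 // -[RHS]rel; apply: eq_bigr => f' _.
  rewrite rmorphM rmorph_prod big_mkord; congr (_ * _); apply: eq_bigr => i _.
  by rewrite rmorphXn EE /= reprK.
by move=> /eqP c0; have := fiber_const_prime (Q 0%N) vf; rewrite c0 idealr0.
Qed.

End KrullUpperBound.

(** * Primes from faces, and the lower bound *)

Section InitialKernel.
Variables (n : nat) (K : fieldType) (A : 'X_{1..n} -> Prop) (I : {pred {mpoly K[n]}}).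
Variables (mf : measure n) (c : nat).

Local Notation F := (fiber_ring I).
Local Notation pi := (\pi_({ideal_quot (@rees_max n K I)})%qT : rees I -> F).

Definition initial_ker (IA : I =i @mon_ideal n K A) (Ac : forall a, A a -> (c <= mf a)%N)
    of (forall i, 0 < mf U_(i)%MM)%N : {pred F} :=
  fun z => initial_morph IA Ac (repr z) == 0.

Variables (IA : I =i @mon_ideal n K A) (Ac : forall a, A a -> (c <= mf a)%N).
Hypothesis mf_gt0 : (forall i, 0 < mf U_(i)%MM)%N.

(** Two representatives differ by an element of [rees_max], whose initial form is zero. *)
Lemma initial_kerE f : (pi f \in initial_ker IA Ac mf_gt0) = (initial_morph IA Ac f == 0).
Proof.
rewrite unfold_in -subr_eq0 -[RHS]subr_eq0 !subr0; congr (_ == 0).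
apply/eqP; rewrite -subr_eq0 -rmorphB; apply/eqP/rees_max_initial => //.
by rewrite Quotient.idealrBE reprK.
Qed.

Lemma initial_ker_idealr : idealr_closed (initial_ker IA Ac mf_gt0).
Proof.
split=> [||z z1 z2].
- by rewrite -(rmorph0 pi) initial_kerE rmorph0.
- by rewrite -(rmorph1 pi) initial_kerE rmorph1 oner_eq0.
rewrite -[z]reprK -[z1]reprK -[z2]reprK -rmorphM -rmorphD !initial_kerE.
by move=> /eqP z10 /eqP z20; rewrite rmorphD rmorphM /= z10 z20 mulr0 addr0.
Qed.

(** This is the kernel of a morphism into the domain S[t]. *)
Lemma initial_ker_prime : prime_idealr_closed (initial_ker IA Ac mf_gt0).
Proof.
by move=> z1 z2; rewrite -[z1]reprK -[z2]reprK -rmorphM !initial_kerE rmorphM mulf_eq0.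
Qed.

HB.instance Definition _ := isIdealr.Build F (initial_ker IA Ac mf_gt0) initial_ker_idealr.
HB.instance Definition _ :=
  isPrimeIdealrClosed.Build F (initial_ker IA Ac mf_gt0) initial_ker_prime.

Definition initial_prime : prime_idealr F := initial_ker IA Ac mf_gt0.

End InitialKernel.

Section Weights.
Variables (n : nat) (w : 'I_n -> nat).

Definition wdeg (m : 'X_{1..n}) : nat := (\sum_i w i * m i)%N.

Lemma wdeg0 : wdeg 0%MM = 0%N.
Proof. by rewrite /wdeg big1 // => i _; rewrite mnm0E muln0. Qed.

Lemma wdegD : {morph wdeg : a b / (a + b)%MM >-> (a + b)%N}.
Proof. by move=> a b; rewrite /wdeg -big_split; apply: eq_bigr => i _;
  rewrite mnmDE mulnDr. Qed.

HB.instance Definition _ := isMeasure.Build n wdeg wdeg0 wdegD.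

Lemma wdeg1 i : wdeg U_(i)%MM = w i.
Proof.
rewrite /wdeg (bigD1 i) //= mnm1E eqxx muln1 big1 ?addn0 // => j /negbTE ji.
by rewrite mnm1E eq_sym ji muln0.
Qed.

End Weights.

Section KrullLowerBound.
Variables (n : nat) (K : fieldType) (A : 'X_{1..n} -> Prop) (I : {pred {mpoly K[n]}}).
Hypothesis IA : I =i @mon_ideal n K A.

(** The k factors have weight at least c each and the total is c k. So each factor has weight
    exactly c, and the cofactor has weight 0, hence is 1 because the variables have positive
    weight. *)
Lemma ksum_tight (mf : measure n) c k m m' :
  (forall a, A a -> c <= mf a)%N -> (forall i, 0 < mf U_(i)%MM)%N ->
  ksum A k m' -> (m' <= m)%MM -> mf m = (c * k)%N ->
  ksum (fun a => A a /\ mf a = c) k m.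
Proof.
move=> Ac mf_gt0 [s [sk sA ->]] sm mk.
have mD := mfD (s := mf).
have le_s (r : seq 'X_{1..n}) : {subset r <= s} -> (c * size r <= mf (\sum_(a <- r) a)%MM)%N.
  by move=> rs; apply: mf_ksum Ac _ _ _; exists r; split=> // a /rs/sA.
have mE : m = (\sum_(a <- s) a)%MM.
  rewrite -(submK sm); suff -> : (m - \sum_(a <- s) a)%MM = 0%MM by rewrite add0m.
  have d0 : mf (m - \sum_(a <- s) a)%MM = 0%N.
    by have := le_s s (fun _ => id); move: mk; rewrite -{1}(submK sm) mD sk; lia.
  apply/mnmP=> i; rewrite mnm0E; apply/eqP/negPn/negP; rewrite -lep1mP => ib.
  by move: d0; rewrite -(submK ib) mD; have := mf_gt0 i; lia.
exists s; split=> // a /[dup] as_ /sA Aa; split=> //.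
apply/eqP; rewrite eqn_leq Ac // andbT.
have := le_s (rem a s) (@mem_rem _ _ _); have := perm_to_rem as_ => ps.
move: mk; rewrite mE (perm_big _ ps) big_cons mD -sk (perm_size ps) /= mulnS.
by lia.
Qed.

Lemma ksum_eq (mf : measure n) c k m :
  ksum (fun a => mf a = c) k m -> mf m = (c * k)%N.
Proof.
case=> s [<- sA ->]; elim: s sA => [|a s IHs] sA; first by rewrite big_nil mf0 muln0.
rewrite big_cons mfD mulnS sA ?mem_head ?IHs // => b bs.
by apply: sA; rewrite inE bs orbT.
Qed.

Lemma ksum_sub (P Q : 'X_{1..n} -> Prop) k m :
  (forall a, P a -> Q a) -> ksum P k m -> ksum Q k m.
Proof. by move=> PQ [s [sk sP ->]]; exists s; split=> // a /sP/PQ. Qed.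

Section Step.
Variables (mf1 mf2 : measure n) (c1 c2 : nat).
Hypotheses (A1 : forall a, A a -> (c1 <= mf1 a)%N) (A2 : forall a, A a -> (c2 <= mf2 a)%N).
Hypotheses (gt1 : forall i, (0 < mf1 U_(i)%MM)%N) (gt2 : forall i, (0 < mf2 U_(i)%MM)%N).
Hypothesis face : forall a, A a -> mf2 a = c2 -> mf1 a = c1.

(** By [ksum_tight], a monomial surviving in the second initial form is a product of generators on
    the smaller face, so it survives in the first one too. *)
Lemma initial_prime_sub :
  {subset (initial_prime IA A1 gt1 : {pred fiber_ring I}) <=
          (initial_prime IA A2 gt2 : {pred fiber_ring I})}.
Proof.
move=> z; rewrite -[z]reprK; move: (repr z) => f {z}.
rewrite !initial_kerE => /eqP f1; apply/eqP/polyP=> k; apply/mpolyP=> m.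
rewrite coef0 mcoeff0 coef_initial_form mcoeff_pihomog.
have [mk|_] := eqVneq (mf2 m) (c2 * k)%N; last by [].
rewrite mulr1n; apply: contrapT => /eqP; rewrite -mcoeff_msupp => ms.
have fk : (val f)`_k \in ideal_exp I k by apply/rees_predP; case: f {f1 ms}.
move: (fk); rewrite (ideal_exp_mon k IA) => /mon_ideal_coef/(_ ms)[a ka am].
have /(ksum_sub (Q := fun a => mf1 a = c1)) km := ksum_tight A2 gt2 ka am mk.
have m1 : mf1 m = (c1 * k)%N by apply/ksum_eq/km => b [] /face.
have /mpolyP/(_ m) : (initial_morph IA A1 f)`_k = 0 by rewrite f1 coef0.
rewrite coef_initial_form mcoeff_pihomog m1 eqxx mulr1n mcoeff0 => /eqP.
by rewrite mcoeff_eq0 ms.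
Qed.

(** The element x^g t separates the primes: its second initial form is zero and its first one is
    not. *)
Lemma initial_prime_not_sub g : A g -> mf1 g = c1 -> mf2 g <> c2 ->
  ~ {subset (initial_prime IA A2 gt2 : {pred fiber_ring I}) <=
            (initial_prime IA A1 gt1 : {pred fiber_ring I})}.
Proof.
move=> Ag g1 g2.
have fP : ('X_[g])%:P * 'X \in rees_pred I.
  apply/rees_predP=> k; rewrite coefMX; case: k => [//|[|k]]; rewrite coefC /=.
    have := ideal_exp_mon 1 IA; rewrite /= => ->; apply: mem_mon_ideal.
    by exists [:: g]; rewrite big_seq1; split=> // a; rewrite inE => /eqP->.
  exact: ideal_gen0.
pose f : rees I := Rees fP.
have coeff (mf : measure n) c k m : (initial_form mf c f)`_k@_m
     = ((k == 1%N) && (g == m))%:R *+ (mf m == c * k)%N.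
  rewrite coef_initial_form mcoeff_pihomog; congr (_ *+ _).
  rewrite [val f]/= coefMX; case: k => [|[|k]]; rewrite ?mcoeff0 // coefC /= ?mcoeff0 //.
  by rewrite mcoeffX.
move=> /(_ (\pi_({ideal_quot (@rees_max n K I)})%qT f)); rewrite !initial_kerE.
have -> : initial_morph IA A2 f = 0.
  apply/polyP=> k; apply/mpolyP=> m; rewrite coeff coef0 mcoeff0.
  case: (k =P 1%N) => [->|]; last by rewrite mul0rn.
  case: (g =P m) => [<-|]; last by rewrite mul0rn.
  by rewrite muln1; case: eqP.
rewrite eqxx => /(_ isT)/eqP/polyP/(_ 1%N)/mpolyP/(_ g).
rewrite coeff coef0 mcoeff0 muln1 g1 !eqxx => /eqP.
by rewrite oner_eq0.
Qed.

End Step.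

(** Strictly decreasing faces [wdeg (w j) = c j] give strictly increasing primes. A bound [c j] that
    is not attained describes the empty face. *)
Lemma krull_dim_ge d (w : nat -> 'I_n -> nat) (c : nat -> nat) :
  (forall j i, 0 < w j i)%N -> (forall j a, A a -> c j <= wdeg (w j) a)%N ->
  (forall j a, (j < d)%N -> A a -> wdeg (w j.+1) a = c j.+1 -> wdeg (w j) a = c j) ->
  (forall j, (j < d)%N -> exists g,
     [/\ A g, wdeg (w j) g = c j & wdeg (w j.+1) g <> c j.+1]) ->
  prime_chain (fiber_ring I) d.
Proof.
move=> w_gt0 Ac face strict.
have gt0 j i : (0 < wdeg (w j) U_(i)%MM)%N by rewrite wdeg1.
pose P j : prime_idealr (fiber_ring I) := initial_prime IA (Ac j) (gt0 j).
have face' i j a : (i <= j <= d)%N -> A a -> wdeg (w j) a = c j -> wdeg (w i) a = c i.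
  case/andP=> /subnK <-; elim: (j - i)%N => // k IHk kd Aa /face wk.
  by apply: IHk => //; [apply: ltnW|apply: wk].
exists (fun i => P (val i)) => i j ij; have jd : (j <= d)%N by rewrite -ltnS.
split.
  by apply: initial_prime_sub => a Aa; apply: face' => //; rewrite ltnW.
have [g [Ag gi gi1]] := strict i (leq_trans ij jd).
apply: (initial_prime_not_sub (g := g)) => // gj; apply: gi1.
by apply: face' gj => //; rewrite ij.
Qed.

End KrullLowerBound.

Local Close Scope ring_scope.

(** * Principal 2-Borel ideals of degree four *)

Lemma ternary_lt (f : nat -> nat) k : (forall i, f i <= 2) -> \sum_(i < k) 3 ^ i * f i < 3 ^ k.
Proof.
move=> f2; elim: k => [|k IHk]; first by rewrite big_ord0.
rewrite big_ord_recr /= expnS; move: IHk (f2 k); move: (3 ^ k) (f k) (\sum_(i < k) _) => P c s.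
by move: c => [|[|[|c]]]; lia.
Qed.

Lemma ternary_inj (f g : nat -> nat) k : (forall i, f i <= 2) -> (forall i, g i <= 2) ->
  \sum_(i < k) 3 ^ i * f i = \sum_(i < k) 3 ^ i * g i -> forall i, i < k -> f i = g i.
Proof.
move=> f2 g2; elim: k => // k IHk; rewrite !big_ord_recr /= => E.
have := ternary_lt k f2; have := ternary_lt k g2; move: E IHk.
set F := \sum_(i < k) _; set G := \sum_(i < k) _ => E IHk ltG ltF.
have fgk : f k = g k.
  have := g2 k; have := f2 k; move: ltF ltG E; move: (3 ^ k) (f k) (g k) => P.
  by move=> [|[|[|?]]] [|[|[|?]]]; lia.
have FG : F = G by move: E; rewrite fgk => /addIn.
by move=> i; rewrite ltnS leq_eqVlt => /predU1P[->|/(IHk FG)].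
Qed.

Section ExponentLists.
Variable n : nat.
Implicit Types (a u : 'X_{1..n}) (s : seq nat).

(* Additive, injective on 2-bounded monomials, and larger on later variables. *)
Definition ternary : 'X_{1..n} -> nat := wdeg (fun i : 'I_n => 3 ^ i).

Lemma ternaryE a : ternary a = \sum_(i < n) 3 ^ i * nth 0 a i.
Proof. by apply: eq_bigr => i _; rewrite (mnm_nth 0). Qed.

Lemma nth_kbounded k a i : kbounded k a -> nth 0 a i <= k.
Proof.
move=> ak; case: (ltnP i n) => [ni|ni]; last by rewrite nth_default // size_tuple.
by have := ak (Ordinal ni); rewrite (mnm_nth 0).
Qed.

Lemma ternary_injective a b : kbounded 2 a -> kbounded 2 b -> ternary a = ternary b -> a = b.
Proof.
move=> a2 b2; rewrite !ternaryE => /ternary_inj E; apply/mnmP=> i; rewrite !(mnm_nth 0).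
by apply: E => // j; apply: nth_kbounded.
Qed.

Lemma tail_eq0P t a : reflect (forall i : 'I_n, t <= i -> a i = 0) (tail t a == 0).
Proof.
rewrite /tail sum_nat_eq0; apply: (iffP forall_inP) => [E i /E/eqP //|E i /E ->//].
Qed.

(** The monomials in the first k variables thus form an initial stage of the induction in
    [freiman_ind]. *)
Lemma ternary_lt_tail k a : k <= n -> kbounded 2 a ->
  (ternary a < 3 ^ k) = (tail k a == 0).
Proof.
move=> kn a2; apply/idP/tail_eq0P => [lt i ki|a0].
  apply/eqP; rewrite -leqn0 leqNgt; apply: contraTN lt => ai; rewrite -leqNgt.
  rewrite /ternary /wdeg (bigD1 i) //=; apply: leq_trans (leq_addr _ _).
  by apply: (@leq_trans (3 ^ i)); rewrite ?leq_pexp2l // leq_pmulr.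
rewrite ternaryE -[ltnLHS](big_mkord xpredT (fun i => 3 ^ i * nth 0 a i)).
rewrite (big_cat_nat (n := k)) //= [X in _ + X]big_nat_cond [X in _ + X]big1 ?addn0.
  by rewrite big_mkord; apply: ternary_lt => i; apply: nth_kbounded.
by move=> i /andP[/andP[ki ni] _]; have := a0 (Ordinal ni) ki;
  rewrite (mnm_nth 0) => /= ->; rewrite muln0.
Qed.

(** The default 0 of [nth] gives exponent zero to the variables beyond the list. *)
Definition mon_of s : 'X_{1..n} := [multinom nth 0 s i | i < n].

Lemma mon_of_inj k : k <= n -> {in [pred s | size s == k] &, injective mon_of}.
Proof.
move=> kn s t; rewrite !inE => /eqP sk /eqP tk /mnmP st.
apply: (@eq_from_nth _ 0) => [|i]; rewrite sk ?tk // => ik.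
by have := st (Ordinal (leq_trans ik kn)); rewrite !mnmE.
Qed.

Definition add_seq s t := [seq p.1 + p.2 | p <- zip s t].

Lemma mon_ofD s t : size s = size t -> (mon_of s + mon_of t)%MM = mon_of (add_seq s t).
Proof.
move=> st; apply/mnmP=> i; rewrite mnmDE !mnmE.
have [si|si] := ltnP i (size s).
  by rewrite (nth_map (0, 0)) ?size_zip -?st ?minnn // nth_zip.
by rewrite !nth_default // ?size_map ?size_zip -?st ?minnn.
Qed.

Lemma tail_mon_of s t : size s <= n -> tail t (mon_of s) = sumn (drop t s).
Proof.
move=> sn; have [m] := ubnP (n - t); elim: m t => // m IHm t tm.
have [nt|tn] := leqP n t.
  rewrite drop_oversize ?(leq_trans sn) //; apply/eqP/tail_eq0P => i ti.
  by have := leq_trans nt ti; rewrite leqNgt ltn_ord.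
rewrite (tail_ord (Ordinal tn)) mnmE IHm /=; last by lia.
have [ts|st] := ltnP t (size s); first by rewrite (drop_nth 0 ts).
by rewrite nth_default // !drop_oversize // ltnW.
Qed.

Lemma mon_of_take k a : k <= n -> tail k a = 0 -> a = mon_of (take k a).
Proof.
move=> kn /eqP/tail_eq0P a0; apply/mnmP=> i; rewrite mnmE.
have [ik|ki] := ltnP i k; first by rewrite nth_take // (mnm_nth 0).
by rewrite a0 // nth_default // (leq_trans _ ki) // size_take; case: ifP => // /negbT; lia.
Qed.

Fixpoint ternary_seqs k :=
  if k is k'.+1 then [seq x :: s | x <- [:: 0; 1; 2], s <- ternary_seqs k'] else [:: [::]].

Lemma mem_ternary_seqs k s :
  (s \in ternary_seqs k) = (size s == k) && all (fun x => x <= 2) s.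
Proof.
elim: k s => [|k IHk] s; first by case: s.
apply/allpairsP/andP => [[[x t] /= [xs ts ->]]|[]].
  move: ts xs; rewrite IHk !inE /= => /andP[/eqP-> ->] xs; rewrite eqxx andbT.
  by split=> //; move: xs => /or3P[]/eqP->.
case: s => //= x s /eqP[sk] /andP[x2 s2]; exists (x, s); rewrite /= IHk sk eqxx s2.
by split=> //; move: x x2 => [|[|[|]]].
Qed.

Definition borel_seqs k (T : seq nat) :=
  undup [seq s <- ternary_seqs k | (sumn s == 4) &&
    all (fun t => sumn (drop t s) <= nth 0 T t) (iota 0 k)].

Definition sum_seqs k T := undup [seq add_seq s t | s <- borel_seqs k T, t <- borel_seqs k T].

Lemma mem_borel_seqs k T u a : k <= n -> mdeg u = 4 ->
  (forall t, t < k -> nth 0 T t = tail t u) ->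
  (a \in map mon_of (borel_seqs k T)) = (a \in borel_gens 2 u) && (tail k a == 0).
Proof.
move=> kn u4 Tu; apply/mapP/andP => [[s]|].
  rewrite mem_undup mem_filter mem_ternary_seqs => /andP[/andP[/eqP s4 /allP sT]].
  move=> /andP[/eqP sk s2] ->; have sn : size s <= n by rewrite sk.
  rewrite tail_mon_of // drop_oversize ?sk //; split=> //; apply/borel_gensP; split.
    move=> i; rewrite mnmE; have [si|si] := ltnP i (size s); last by rewrite nth_default.
    by move/all_nthP: s2; apply.
  split=> [|t]; first by rewrite -tail0 tail_mon_of // drop0 s4.
  rewrite tail_mon_of //; have [tk|kt] := ltnP t k; last by rewrite drop_oversize ?sk.
  by rewrite -Tu // sT // mem_iota.
move=> [/borel_gensP[a2 [da ta]] /eqP ka]; exists (take k a); last exact: mon_of_take.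
have sk : size (take k a) = k by rewrite size_take size_tuple; case: ltngtP kn.
have tailE t : sumn (drop t (take k a)) = tail t a.
  by rewrite [in RHS](mon_of_take kn ka) tail_mon_of ?sk.
have s4 : sumn (take k a) = 4 by have := tailE 0; rewrite drop0 tail0 da u4.
rewrite mem_undup mem_filter mem_ternary_seqs sk s4 !eqxx /=; apply/andP; split.
  by apply/allP => t; rewrite mem_iota => /andP[_ tk]; rewrite tailE Tu.
apply/(all_nthP 0) => i; rewrite sk => ik; rewrite nth_take //; exact: nth_kbounded.
Qed.

Lemma card_fset_seq (T : choiceType) (X : {fset T}) (r : seq T) :
  uniq r -> X =i r -> #|` X| = size r.
Proof. by move=> ur Xr; apply/perm_size/uniq_perm. Qed.

Section LowVariables.
Variables (k : nat) (T : seq nat) (u : 'X_{1..n}).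
Hypotheses (kn : k <= n) (u4 : mdeg u = 4).
Hypothesis Tu : forall t, t < k -> nth 0 T t = tail t u.

Let A := [fset a in borel_gens 2 u | ternary a < 3 ^ k]%fset.

Lemma mem_low a : (a \in A) = (a \in map mon_of (borel_seqs k T)).
Proof.
rewrite (@mem_borel_seqs k T u a) // !inE /=.
case: (boolP (a \in _)) => //= /borel_gensP[a2 _].
by rewrite ternary_lt_tail.
Qed.

Lemma size_borel_seqs s : s \in borel_seqs k T -> size s = k.
Proof. by rewrite mem_undup mem_filter mem_ternary_seqs => /and3P[_ /eqP]. Qed.

Lemma card_low : #|` A| = size (borel_seqs k T).
Proof.
rewrite (@card_fset_seq _ _ (map mon_of (borel_seqs k T))) ?size_map //.
  rewrite map_inj_in_uniq ?undup_uniq // => s t /size_borel_seqs sk /size_borel_seqs tk.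
  by apply: (mon_of_inj kn); rewrite inE ?sk ?tk.
exact: mem_low.
Qed.

Lemma card_sumset_low : #|` sumset A| = size (sum_seqs k T).
Proof.
have sz s : s \in sum_seqs k T -> size s = k.
  rewrite mem_undup => /allpairsP[[x y] /= [/size_borel_seqs xk /size_borel_seqs yk ->]].
  by rewrite size_map size_zip xk yk minnn.
rewrite (@card_fset_seq _ _ (map mon_of (sum_seqs k T))) ?size_map //.
  rewrite map_inj_in_uniq ?undup_uniq // => s t /sz sk /sz tk.
  by apply: (mon_of_inj kn); rewrite inE ?sk ?tk.
move=> c; apply/sumsetP/mapP => [[a [b []]]|[s]].
  rewrite !mem_low => /mapP[x xs ->] /mapP[y ys ->] ->.
  exists (add_seq x y); first by rewrite mem_undup; apply: allpairs_f.
  by rewrite mon_ofD // (size_borel_seqs xs) (size_borel_seqs ys).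
rewrite mem_undup => /allpairsP[[x y] /= [xs ys ->]] ->.
exists (mon_of x), (mon_of y); rewrite !mem_low !map_f // mon_ofD //.
by rewrite (size_borel_seqs xs) (size_borel_seqs ys).
Qed.

End LowVariables.

End ExponentLists.

(** The 24 lists of tails are checked by computation. Here 6 is C(4, 2), and having at least four
    generators allows [freiman_bound_mono] to replace 4 by the actual rank. *)
Lemma borel_seqs4_excess T1 T2 T3 : 3 <= T1 <= 4 -> 2 <= T2 <= 4 -> 1 <= T3 <= 4 ->
  let T := [:: 4; T1; T2; T3] in 4 <= size (borel_seqs 4 T) /\
  4 * size (borel_seqs 4 T) + 1 <= size (sum_seqs 4 T) + 6.
Proof.
pose ok T1 T2 T3 := let T := [:: 4; T1; T2; T3] in (4 <= size (borel_seqs 4 T)) &&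
  (4 * size (borel_seqs 4 T) + 1 <= size (sum_seqs 4 T) + 6).
have /allP chk : all (fun T1 => all (fun T2 => all (ok T1 T2) (iota 1 4)) (iota 2 3)) (iota 3 2).
  by vm_compute.
move=> h1 h2 h3; have /chk/allP c1 : T1 \in iota 3 2 by rewrite mem_iota; lia.
have /c1/allP c2 : T2 \in iota 2 3 by rewrite mem_iota; lia.
by apply/andP; apply: c2; rewrite mem_iota; lia.
Qed.

(** The span of G and the n - |D| unit vectors outside D together fill the space of dimension n. *)
Lemma dim_span_fset_ge n (G : {fset 'X_{1..n}}) (D : {set 'I_n}) :
  (forall i, i \in D -> vec U_(i)%MM \in span_fset G) -> #|D| <= \dim (span_fset G).
Proof.
move=> GD; pose X := [seq vec U_(i)%MM | i <- enum (~: D)].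
have full : (fullv <= span_fset G + <<X>>)%VS.
  apply/subvP=> v _; rewrite [v]row_sum_delta; apply: rpred_sum => i _; apply: rpredZ.
  have -> : delta_mx 0%R i = vec U_(i)%MM.
    by apply/rowP=> j; rewrite !mxE mnm1E eq_sym /=; case: (i == j).
  have [iD|iD] := boolP (i \in D); first by apply: (subvP (addvSl _ _)); apply: GD.
  apply: (subvP (addvSr _ _)); apply/memv_span/map_f.
  by rewrite mem_enum inE.
have := dimvS full; rewrite dimvf /dim /= mul1n => le1.
have [le2 _] := dimv_add_leqif (span_fset G) <<X>>%VS.
have := leq_trans le1 (leq_trans le2 (leq_add (leqnn _) (dim_span X))).
by rewrite size_map -cardE -[leqLHS]card_ord -(cardsC D) leq_add2r.
Qed.

(** The variables up to the last one dividing u; by [low_varsE] they form an initial segment. *)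
Definition low_vars n (u : 'X_{1..n}) : {set 'I_n} := [set i : 'I_n | 0 < tail i u].

Lemma card_ltn_set n m : m <= n -> #|[set i : 'I_n | i < m]| = m.
Proof.
move=> mn; have <- : [set widen_ord mn j | j in 'I_m] = [set i : 'I_n | i < m].
  apply/setP=> i; rewrite inE; apply/imsetP/idP => [[j _ ->]|im].
    exact: (ltn_ord j).
  by exists (Ordinal im) => //; apply/val_inj.
by rewrite card_imset ?card_ord // => i j /(congr1 val) /= /val_inj.
Qed.

Lemma low_varsE n (u : 'X_{1..n}) (i : 'I_n) : (i \in low_vars u) = (i < #|low_vars u|).
Proof.
have ex : exists t, tail t u == 0.
  by exists n; apply/tail_eq0P => j; rewrite leqNgt ltn_ord.
case: (ex_minnP ex) => m /eqP um mmin.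
have mn : m <= n by apply: mmin; apply/tail_eq0P => j; rewrite leqNgt ltn_ord.
have E : low_vars u = [set i : 'I_n | i < m].
  apply/setP=> j; rewrite !inE; have [jm|mj] := ltnP j m.
    by rewrite lt0n; apply: contraTN jm => /mmin; rewrite leqNgt.
  by apply/negbTE; rewrite -leqNgt -um tail_le.
by rewrite E card_ltn_set // inE.
Qed.

Lemma wdeg_tail n t (a : 'X_{1..n}) : wdeg (fun i : 'I_n => t <= i) a = tail t a.
Proof.
rewrite /wdeg /tail [RHS]big_mkcond; apply: eq_bigr => i _.
by case: (t <= i); rewrite ?mul1n ?mul0n.
Qed.

Lemma wdegDw n (w1 w2 : 'I_n -> nat) a :
  wdeg (fun i => w1 i + w2 i) a = wdeg w1 a + wdeg w2 a.
Proof. by rewrite /wdeg -big_split; apply: eq_bigr => i _; rewrite mulnDl. Qed.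

Lemma card_low_vars_eq n (u : 'X_{1..n}) (k : 'I_n) :
  0 < tail k u -> tail k.+1 u = 0 -> #|low_vars u| = k.+1.
Proof.
move=> tk tk1; have kD : k < #|low_vars u| by rewrite -low_varsE inE.
apply/eqP; rewrite eqn_leq kD andbT leqNgt; apply/negP => k1.
have k1n : k.+1 < n by apply: leq_trans k1 _; rewrite -[leqRHS]card_ord max_card.
by move: k1; rewrite -(low_varsE u (Ordinal k1n)) inE /= tk1.
Qed.

Lemma xmon_cons n (i : 'I_n) s : xmon n (i.+1 :: s) = (U_(i) + xmon n s)%MM.
Proof. by apply/mnmP=> j; rewrite mnmDE !mnmE /= eqSS. Qed.

Lemma xmon4 n (i j k l : 'I_n) :
  xmon n [:: i.+1; j.+1; k.+1; l.+1] = (U_(i) + U_(j) + U_(k) + U_(l))%MM.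
Proof.
by rewrite !xmon_cons !addmA (_ : xmon n [::] = 0%MM) ?addm0.
Qed.

Lemma tail_ge1 n t (a : 'X_{1..n}) : 0 < tail t a -> exists2 i : 'I_n, t <= i & 0 < a i.
Proof.
move=> ta; apply: contrapT => nex; move: ta; rewrite lt0n => /negP; apply.
apply/tail_eq0P => i ti; apply/eqP; rewrite -leqn0 leqNgt; apply/negP => ai.
by apply: nex; exists i.
Qed.

Lemma mon4_eq n (i j k l : 'I_n) (a : 'X_{1..n}) : mdeg a = 4 ->
  (forall m, (i == m) + (j == m) + (k == m) + (l == m) <= a m) ->
  a = (U_(i) + U_(j) + U_(k) + U_(l))%MM.
Proof.
move=> a4 le; symmetry; apply: lepm_mdeg_eq; last by rewrite !mdegD !mdeg1 a4.
by apply/mnm_lepP=> m; rewrite !mnmDE !mnm1E.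
Qed.

(** * Rank and excess of the generators in degree four *)

Section DegreeFour.
Variable n : nat.
Variables o0 o1 o2 : 'I_n.
Hypotheses (e0 : val o0 = 0) (e1 : val o1 = 1) (e2 : val o2 = 2).

(** The digits in the names number the variables from 1, whereas k counts from 0. These generators
    are available for every u in question and suffice for the rank and the chain of primes. *)
Definition mon112 (k : 'I_n) : 'X_{1..n} := (U_(o0) + U_(o0) + U_(o1) + U_(k))%MM.
Definition mon122 (k : 'I_n) : 'X_{1..n} := (U_(o0) + U_(o1) + U_(o1) + U_(k))%MM.

Variable u : 'X_{1..n}.
Hypotheses (u2 : kbounded 2 u) (u4 : mdeg u = 4) (u01 : u o0 <= 1).

Local Notation A := (borel_gens 2 u).
Local Notation D := (low_vars u).
Lemma tail1_u : tail 1 u = 4 - u o0.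
Proof. by have := tail_ord o0 u; rewrite e0 tail0 u4; lia. Qed.

Lemma tail2_u : tail 2 u = tail 1 u - u o1.
Proof. by have := tail_ord o1 u; rewrite e1; lia. Qed.

Lemma tail3_u : tail 3 u = tail 2 u - u o2.
Proof. by have := tail_ord o2 u; rewrite e2; lia. Qed.

Lemma mem_borel_gens_supp a (i : 'I_n) : a \in A -> 0 < a i -> i \in D.
Proof.
move=> /borel_gensP[_ [_ ta]] ai; rewrite inE; apply: leq_trans (ta i).
exact: leq_trans ai (leq_tail a (leqnn i)).
Qed.

Lemma mem_borel_gens_mdeg a : a \in A -> mdeg a = 4.
Proof. by case/borel_gensP=> _ []; rewrite u4. Qed.

Lemma mem_mon112 (k : 'I_n) : 0 < k -> k \in D -> mon112 k \in A.
Proof.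
rewrite inE => k0 kD; apply/borel_gensP; split=> [i|].
  rewrite !mnmDE !mnm1E -!val_eqE /= e0 e1.
  by case: (val i) => [|[|j]] /=; case: eqP => //=; lia.
split=> [|t]; first by rewrite -tail0 !tailD !tail1 u4.
rewrite !tailD !tail1 e0 e1; have t1 := tail1_u.
case: t => [|[|t]] /=; first by rewrite tail0 u4.
  by rewrite t1; move: u01; case: (1 <= k); lia.
by case: leqP => // tk; apply: leq_trans (tail_le u tk).
Qed.

Lemma mem_mon122 (k : 'I_n) : 1 < k -> k \in D -> mon122 k \in A.
Proof.
rewrite inE => k1 kD; apply/borel_gensP; split=> [i|].
  rewrite !mnmDE !mnm1E -!val_eqE /= e0 e1.
  by case: (val i) => [|[|j]] /=; case: eqP => //=; lia.
split=> [|t]; first by rewrite -tail0 !tailD !tail1 u4.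
rewrite !tailD !tail1 e0 e1; have t1 := tail1_u.
case: t => [|[|t]] /=; first by rewrite tail0 u4.
  by rewrite t1; move: u01; case: (1 <= k); lia.
by case: leqP => // tk; apply: leq_trans (tail_le u tk).
Qed.

Lemma low_vars1 : o1 \in D.
Proof. by rewrite inE e1 tail1_u; lia. Qed.

Lemma low_vars2 : o2 \in D.
Proof. by rewrite inE e2 tail2_u tail1_u; have := u2 o1; lia. Qed.

(** The difference of [mon112 o2] and [mon122 o2] is E o0 - E o1, and [mon112 o1] is 2 (E o0 + E
    o1); this gives E o0 and E o1, and then [mon112 k] gives every other unit vector. *)
Lemma card_low_vars_dim : #|D| <= \dim (span_fset A).
Proof.
apply: dim_span_fset_ge.
have p1 : vec (mon112 o1) \in span_fset A.
  by apply/mem_span_fset/mem_mon112; rewrite ?e1 ?low_vars1.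
have p2 : vec (mon112 o2) \in span_fset A.
  by apply/mem_span_fset/mem_mon112; rewrite ?e2 ?low_vars2.
have q2 : vec (mon122 o2) \in span_fset A.
  by apply/mem_span_fset/mem_mon122; rewrite ?e2 ?low_vars2.
set V := span_fset A in p1 p2 q2 *.
pose E (i : 'I_n) := vec U_(i)%MM.
have v0 : E o0 \in V.
  have -> : E o0 = (4%:R^-1 *: (vec (mon112 o1) + 2%:R *: (vec (mon112 o2) - vec (mon122 o2))))%R.
    by rewrite !vecD -/(E _); apply/rowP=> i; rewrite !mxE; field.
  by rewrite memvZ // memvD // memvZ // memvB.
have v1 : E o1 \in V.
  have -> : E o1 = (E o0 - (vec (mon112 o2) - vec (mon122 o2)))%R.
    by rewrite !vecD -/(E _); apply/rowP=> i; rewrite !mxE; ring.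
  by rewrite memvB // memvB.
move=> k kD; have [k0|k0] := posnP k.
  by have -> : k = o0 by apply/val_inj; rewrite e0.
have -> : vec U_(k)%MM = (vec (mon112 k) - (E o0 + E o0 + E o1))%R.
  by rewrite !vecD -/(E _); apply/rowP=> i; rewrite !mxE; ring.
by rewrite memvB ?memvD // mem_span_fset // mem_mon112.
Qed.

Lemma ternary_inj_borel_gens : {in A &, injective (@ternary n)}.
Proof. by move=> a b /borel_gensP[a2 _] /borel_gensP[b2 _]; apply: ternary_injective. Qed.

Lemma ternaryD a b : ternary (a + b) = @ternary n a + ternary b.
Proof. exact: wdegD. Qed.

(** The rank is at least |D| and at most |A|, so by monotonicity an excess for the rank is one for
    every smaller l, in particular for the analytic spread. *)
Lemma low_freiman_bound d :
  \dim (span_fset A) * #|` A| + d <= #|` sumset A| + 'C(\dim (span_fset A), 2) ->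
  forall l, l <= #|D| -> l * #|` A| + d <= #|` sumset A| + 'C(l, 2).
Proof.
move=> ex l lD; have rA := dim_span_fset A.
have := @freiman_bound_mono l (\dim (span_fset A)) #|` A|.
by rewrite rA (leq_trans lD card_low_vars_dim) => /(_ isT); move: ex; lia.
Qed.

Lemma low_excess : 3 <= tail 1 u -> 2 <= tail 2 u -> 1 <= tail 3 u ->
  forall l, l <= #|D| -> l * #|` A| + 1 <= #|` sumset A| + 'C(l, 2).
Proof.
move=> t1 t2 t3; apply: low_freiman_bound.
have n4 : 4 <= n.
  rewrite leqNgt; apply/negP => n3; move: t3; rewrite ltnNge leqn0 => /negP; apply.
  by apply/tail_eq0P => i; have := ltn_ord i; lia.
have t_le4 t : tail t u <= 4 by rewrite -u4 -tail0 tail_le.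
pose T := [:: 4; tail 1 u; tail 2 u; tail 3 u].
have TE t : t < 4 -> nth 0 T t = tail t u.
  by case: t => [|[|[|[|]]]] //= _; rewrite tail0.
have ex4 := borel_seqs4_excess (T1 := tail 1 u) (T2 := tail 2 u) (T3 := tail 3 u).
rewrite t1 t2 t3 !t_le4 /= in ex4; have {ex4} := ex4 isT isT isT.
rewrite -(card_low n4 u4 TE) -(card_sumset_low n4 u4 TE) => -[c4 ex4].
(* Weight below 3^4 singles out the generators in the first four variables, whose excess has been
   computed. *)
apply: (freiman_ind ternaryD (c0 := 3 ^ 4) ternary_inj_borel_gens).
set A4 := [fset a in A | _]%fset in c4 ex4 *.
have r4 : \dim (span_fset A4) <= 4.
  pose X := [seq oapp (fun i : 'I_n => vec U_(i)%MM) 0%R (insub i) | i <- iota 0 4].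
  apply: leq_trans (_ : \dim <<X>> <= 4); last exact: dim_span.
    apply: dimvS; apply: span_fset_le => a.
    rewrite !inE /= => /andP[/borel_gensP[a2 _]]; rewrite ternary_lt_tail // => /tail_eq0P a0.
    rewrite [vec a]row_sum_delta; apply: rpred_sum => i _.
    have [i4|i4] := ltnP i 4; last by rewrite mxE a0 // scale0r mem0v.
    have -> : delta_mx 0%R i = vec U_(i)%MM.
      by apply/rowP=> j; rewrite !mxE mnm1E eq_sym /=; case: (i == j).
    by apply/memvZ/memv_span/mapP; exists (val i); rewrite ?mem_iota ?valK.
have := @freiman_bound_mono (\dim (span_fset A4)) 4 #|` A4|.
by rewrite r4 c4 => /(_ isT); move: ex4; rewrite (_ : 'C(4, 2) = 6) //; lia.
Qed.

(** The exponent bounds force tail 2 u >= 1. Equality leaves x_1 x_2^2 times a later variable; if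
    tail 2 u >= 2 and tail 3 u = 0, the exponent of x_3 is 2 and two monomials remain. *)
Lemma borel_gens_classification :
  [\/ u = (U_(o0) + U_(o1) + U_(o2) + U_(o2))%MM,
      u = (U_(o1) + U_(o1) + U_(o2) + U_(o2))%MM,
      exists2 i : 'I_n, 2 <= i & u = (U_(o0) + U_(o1) + U_(o1) + U_(i))%MM
    | [/\ 3 <= tail 1 u, 2 <= tail 2 u & 1 <= tail 3 u]].
Proof.
have t1 := tail1_u; have t2 := tail2_u.
have t3 := tail3_u.
have b1 := u2 o1; have b2 := u2 o2.
have o01 : (o0 == o1) = false by rewrite -val_eqE /= e0 e1.
have o02 : (o0 == o2) = false by rewrite -val_eqE /= e0 e2.
have o12 : (o1 == o2) = false by rewrite -val_eqE /= e1 e2.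
have [t2u|] := leqP 2 (tail 2 u); last first.
  move=> t2u; have [i i2 ui] : exists2 i : 'I_n, 2 <= i & 0 < u i by apply: tail_ge1; lia.
  apply: Or43; exists i => //; apply: mon4_eq => // m.
  have oi0 : (o0 == i) = false by rewrite -val_eqE /= e0; case: (val i) i2.
  have oi1 : (o1 == i) = false by rewrite -val_eqE /= e1; case: (val i) i2 => [|[]].
  have [<-|_] := eqVneq o0 m; first by rewrite ![_ == o0]eq_sym o01 oi0; lia.
  have [<-|_] := eqVneq o1 m; first by rewrite [_ == o1]eq_sym oi1; lia.
  by have [<-|_] := eqVneq i m; lia.
have [t3u|] := leqP 1 (tail 3 u); first by apply: Or44; split=> //; lia.
rewrite ltnS leqn0 => /eqP t3u.
have [u0|u0] := leqP 1 (u o0); [apply: Or41|apply: Or42]; apply: mon4_eq => // m.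
  have [<-|_] := eqVneq o0 m; first by rewrite ![_ == o0]eq_sym o01 o02; lia.
  have [<-|_] := eqVneq o1 m; first by rewrite [_ == o1]eq_sym o12; lia.
  by have [<-|_] := eqVneq o2 m; lia.
have [<-|_] := eqVneq o1 m; first by rewrite [_ == o1]eq_sym o12; lia.
by have [<-|_] := eqVneq o2 m; lia.
Qed.

(** * Analytic spread and the Freiman property *)

Variable K : fieldType.
Local Notation I := (kBorel_gen K 2 u).

Lemma fiber_krull_dim_le e : prime_chain (fiber_ring I) e -> e <= #|D|.
Proof.
apply: (@krull_dim_le n K A I (kBorel_gen_mon u2) 4 D isT) => [a|a i].
  exact: mem_borel_gens_mdeg.
exact: mem_borel_gens_supp.
Qed.

(* The weights cut out a flag of faces of the Newton polytope: the variables of index at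
   least 3 are removed one at a time, and then come an edge, a vertex and the empty face. *)
Definition flag_weight s j : 'I_n -> nat :=
  if j <= s then fun i => (0 <= i) + (0 <= i) + (s.+3 - j <= i)
  else if j == s.+1 then fun i => (0 <= i) + (1 <= i) + (3 <= i)
  else if j == s.+2 then fun i => (0 <= i) + (1 <= i) + (2 <= i)
  else fun i => (0 <= i).

(** The values 8 and 6 are the minima 4 + 4 and 4 + 2, as generators have degree 4 and tail 1 at
    least 2. The last value 3 lies below the degree, which makes the last face empty. *)
Definition flag_min s j := if j <= s then 8 else if j <= s.+2 then 6 else 3.

Lemma fiber_prime_chain : prime_chain (fiber_ring I) #|D|.
Proof.
have D3 : 3 <= #|D| by have := low_vars2; rewrite low_varsE e2.
pose s := #|D| - 3; have sE : #|D| = s.+3 by rewrite /s; lia.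
have tail1_ge a : a \in A -> 2 <= tail 1 a.
  move=> /[dup] /mem_borel_gens_mdeg a4 /borel_gensP[a2 _].
  by have := tail_ord o0 a; have := a2 o0; rewrite e0 tail0 a4; lia.
have wE j a : a \in A -> wdeg (flag_weight s j) a =
    if j <= s then 8 + tail (s.+3 - j) a else if j == s.+1 then 4 + tail 1 a + tail 3 a
    else if j == s.+2 then 4 + tail 1 a + tail 2 a else 4.
  move=> /mem_borel_gens_mdeg a4; rewrite /flag_weight.
  by do ![case: ifP => _]; rewrite ?wdegDw !wdeg_tail tail0 a4.
apply: (krull_dim_ge (kBorel_gen_mon u2) (w := flag_weight s) (c := flag_min s)).
- by move=> j i; rewrite /flag_weight; do ![case: ifP => _].
- move=> j a aA; rewrite wE // /flag_min; have := tail1_ge a aA.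
  by do ![case: ifP => //]; lia.
- move=> j a jD aA; rewrite !wE // /flag_min; have := tail1_ge a aA.
  have t23 := @tail_le n 2 3 a isT; have := @tail_le n (s.+3 - j.+1) (s.+3 - j) a.
  have t3 : j = s -> tail (s.+3 - j) a = tail 3 a by move=> ->; congr tail; lia.
  by do ![case: ifP]; lia.
have t112 t (k : 'I_n) : tail t (mon112 k) = (t <= 0) + (t <= 0) + (t <= 1) + (t <= k).
  by rewrite !tailD !tail1 e0 e1.
have t122 t (k : 'I_n) : tail t (mon122 k) = (t <= 0) + (t <= 1) + (t <= 1) + (t <= k).
  by rewrite !tailD !tail1 e0 e1.
have p1A : mon112 o1 \in A by apply: mem_mon112; rewrite ?e1 ?low_varsE ?e1; lia.
have p2A : mon112 o2 \in A by apply: mem_mon112; rewrite ?e2 ?low_varsE ?e2; lia.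
have q2A : mon122 o2 \in A by apply: mem_mon122; rewrite ?e2 ?low_varsE ?e2; lia.
(* The witnesses on face j but not on the next one are x_1^2 x_2 times the variable about to be
   removed, then x_1 x_2^2 x_3, x_1^2 x_2 x_3 and x_1^2 x_2^2. *)
move=> j jD; have [js|js] := ltnP j s.
  have Dn : #|D| <= n by rewrite -[leqRHS]card_ord max_card.
  have kn : s.+2 - j < n by lia.
  have kA : mon112 (Ordinal kn) \in A by apply: mem_mon112; rewrite ?low_varsE ?sE /=; lia. 
  exists (mon112 (Ordinal kn)); rewrite !wE // /flag_min js ltnW // !t112 /=.
  by split=> //; lia.
have [->|js1] := eqVneq j s.
  exists (mon122 o2); rewrite !wE // /flag_min !t122 e2.
  have s3 : s.+3 - s = 3 by lia.
  by split=> //; rewrite ?s3 ?leqnn ?ltnn ?eqxx ?leqnSn.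
have [->|js2] := eqVneq j s.+1.
  exists (mon112 o2); rewrite !wE // /flag_min !t112 e2.
  by split=> //; do ![case: ifP]; lia.
have -> : j = s.+2 by lia.
exists (mon112 o1); rewrite !wE // /flag_min !t112 e1.
by split=> //; do ![case: ifP]; lia.
Qed.

Lemma min_mon_gens_borel G : min_mon_gens I G <-> G = A.
Proof.
exact: min_mon_gens_equigenerated (kBorel_gen_mon u2) (mem_borel_gens_mdeg).
Qed.

Lemma min_mon_gens_borel_sqr G : min_mon_gens (ideal_exp I 2) G <-> G = sumset A.
Proof.
apply: (@min_mon_gens_equigenerated n K _ _ _ 8);
  first exact: ideal_sqr_mon (kBorel_gen_mon u2).
move=> _ /sumsetP[a [b [aA bA ->]]].
by rewrite mdegD !mem_borel_gens_mdeg.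
Qed.

(** The opposite inequality is Freiman's, so an upper bound for the number of sums is enough. *)
Lemma freiman_borel : #|` sumset A| + 'C(#|D|, 2) <= #|D| * #|` A| -> freiman I.
Proof.
move=> le; exists A, (sumset A), #|D|; split.
- exact/min_mon_gens_borel.
- by move=> a b aA bA; rewrite !mem_borel_gens_mdeg.
- exact/min_mon_gens_borel_sqr.
- by split; [apply: fiber_prime_chain|apply: fiber_krull_dim_le].
have ge := freiman_ineq ternaryD (ternary_inj_borel_gens).
have := @low_freiman_bound 0.
rewrite !addn0 => /(_ ge #|D| (leqnn _)); rewrite addn0 => {}ge.
apply/eqP; rewrite eq_sym subr_eq -PoszD -PoszM eqz_nat eqn_leq le.
by rewrite (leq_trans ge).
Qed.

Lemma not_freiman_borel : 3 <= tail 1 u -> 2 <= tail 2 u -> 1 <= tail 3 u -> ~ freiman I.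
Proof.
move=> t1 t2 t3 [G [G2 [l [/min_mon_gens_borel -> _ /min_mon_gens_borel_sqr -> [chain _]]]]].
move/eqP; rewrite eq_sym subr_eq -PoszD -PoszM eqz_nat => /eqP E.
have := low_excess t1 t2 t3 (fiber_krull_dim_le chain).
by rewrite E; lia.
Qed.

(** All generators involve only the first three variables, so the computed lists describe the whole
    of A; the summand 3 is C(3, 2). *)
Lemma freiman_three_vars : tail 3 u = 0 ->
  let T := [:: 4; tail 1 u; tail 2 u] in
  size (sum_seqs 3 T) + 3 <= 3 * size (borel_seqs 3 T) -> freiman (kBorel_gen K 2 u).
Proof.
move=> t3 T; have n3 : 3 <= n by have := ltn_ord o2; rewrite -[nat_of_ord o2]/(val o2) e2.
have D3 : #|D| = 3.
  have := low_vars2; rewrite inE => t2.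
  by have := card_low_vars_eq t2; rewrite -[nat_of_ord o2]/(val o2) e2; apply.
have TE t : t < 3 -> nth 0 T t = tail t u.
  by case: t => [|[|[|]]] //= _; rewrite tail0.
have AE : A = [fset a in A | ternary a < 3 ^ 3]%fset.
  apply/fsetP=> a; rewrite !inE /=; case: (boolP (a \in A)) => //= /borel_gensP[a2 [_ ta]].
  by rewrite ternary_lt_tail //; have := ta 3; rewrite t3 leqn0 => ->.
rewrite -(card_low n3 u4 TE) -(card_sumset_low n3 u4 TE) -AE => le.
by apply: freiman_borel; rewrite D3.
Qed.

End DegreeFour.

(** * The family x_1 x_2^2 x_i *)

Lemma sumn_predn_iota N : sumn [seq j.-1 | j <- iota 2 N] = 'C(N.+1, 2).
Proof.
elim: N => // N IHN.
have -> : iota 2 N.+1 = iota 2 N ++ [:: N.+2] by rewrite -[in LHS](addn1 N) iotaD.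
by rewrite map_cat sumn_cat IHN /= addn0 [in RHS]binS bin1.
Qed.

Section FreimanFamily.
Variables (n : nat) (K : fieldType).
Variables o0 o1 o2 : 'I_n.
Hypotheses (e0 : val o0 = 0) (e1 : val o1 = 1) (e2 : val o2 = 2).
Variable k : 'I_n.
Hypothesis k2 : 2 <= k.

Let u := mon122 o0 o1 k.
Local Notation A := (borel_gens 2 u).
Local Notation D := (low_vars u).

Let o01 : (o0 == o1) = false. Proof. by rewrite -val_eqE /= e0 e1. Qed.

Let o0k (i : 'I_n) : 2 <= i -> (o0 == i) = false.
Proof. by rewrite -val_eqE /= e0; case: (val i). Qed.

Let o1k (i : 'I_n) : 2 <= i -> (o1 == i) = false.
Proof. by rewrite -val_eqE /= e1; case: (val i) => [|[]]. Qed.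

Lemma tail_mon122 t (i : 'I_n) :
  tail t (mon122 o0 o1 i) = (t <= 0) + (t <= 1) + (t <= 1) + (t <= i).
Proof. by rewrite !tailD !tail1 e0 e1. Qed.

Lemma mon122_bounded : kbounded 2 u.
Proof.
move=> i; rewrite !mnmDE !mnm1E; have [<-|_] := eqVneq o0 i.
  by rewrite eq_sym o01 eq_sym o0k.
by have [<-|_] := eqVneq o1 i; [rewrite eq_sym o1k|case: (k == i)].
Qed.

Lemma mon122_mdeg : mdeg u = 4.
Proof. by rewrite !mdegD !mdeg1. Qed.

Lemma mon122_o0 : u o0 <= 1.
Proof. by rewrite !mnmDE !mnm1E eqxx eq_sym o01 eq_sym o0k. Qed.

Lemma card_low_vars_mon122 : #|D| = k.+1.
Proof. by apply: card_low_vars_eq; rewrite tail_mon122; lia. Qed.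

(** Indices are natural numbers so that lists can be built from [iota]; the range [iota 2 k.-1] is
    2, ..., k, where the default o0 is never reached. *)
Definition family_index (i : nat) : 'I_n := insubd o0 i.
Local Notation p i := (mon112 o0 o1 (family_index i)).
Local Notation q i := (mon122 o0 o1 (family_index i)).
Local Notation b := (mon112 o0 o1 o1).
Definition family_gens := b :: [seq p i | i <- iota 2 k.-1] ++ [seq q i | i <- iota 2 k.-1].

Lemma family_indexK (i : 'I_n) : family_index i = i.
Proof. by rewrite /family_index /insubd valK. Qed.

Lemma val_family_index i : i \in iota 2 k.-1 -> val (family_index i) = i.
Proof.
rewrite mem_iota => /andP[_ ik]; rewrite val_insubd ifT //.
by apply: leq_ltn_trans (ltn_ord k); lia.
Qed.

(** As tail 2 u = 1, a generator has at most one factor beyond x_2. Without one it is x_1^2 x_2^2;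
    otherwise its exponents in x_1 and x_2 are 2, 1 or 1, 2. *)
Lemma mem_family_gens a : (a \in A) = (a \in family_gens).
Proof.
apply/idP/idP; last first.
  rewrite inE mem_cat => /predU1P[->|/orP[]/mapP[i ik ->]].
  - apply: (mem_mon112 e0 e1 e2 mon122_mdeg mon122_o0); rewrite ?e1 //.
    by rewrite low_varsE card_low_vars_mon122 -[nat_of_ord o1]/(val o1) e1; lia.
  - move: (ik); rewrite mem_iota => ik'.
    apply: (mem_mon112 e0 e1 e2 mon122_mdeg mon122_o0).
      by rewrite -[nat_of_ord _]/(val _) val_family_index //; lia.
    rewrite low_varsE card_low_vars_mon122 -[nat_of_ord (family_index i)]/(val _).
    by rewrite val_family_index //; lia.
  - move: (ik); rewrite mem_iota => ik'.
    apply: (mem_mon122 e0 e1 e2 mon122_mdeg mon122_o0).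
      by rewrite -[nat_of_ord _]/(val _) val_family_index //; lia.
    rewrite low_varsE card_low_vars_mon122 -[nat_of_ord (family_index i)]/(val _).
    by rewrite val_family_index //; lia.
move=> /borel_gensP[a2 [a4 ta]]; rewrite mon122_mdeg in a4.
have := tail_ord o0 a; have := tail_ord o1 a; rewrite e0 e1 tail0 a4 => t1 t0.
have := ta 1; have := ta 2; rewrite !tail_mon122 k2 /= => ta2 ta1.
have b0 := a2 o0; have b1 := a2 o1.
have [t2|] := posnP (tail 2 a).
  rewrite inE; apply/orP; left; apply/eqP/mon4_eq => // m.
  have [<-|_] := eqVneq o0 m; first by rewrite eq_sym o01; lia.
  by have [<-|_] := eqVneq o1 m; lia.
move=> t2; have [i i2 ai] := tail_ge1 t2.
have ik : i <= k.
  by rewrite leqNgt; apply/negP => ki; have := ta i; have := leq_tail a (leqnn i);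
    rewrite tail_mon122; lia.
have iI : (i : nat) \in iota 2 k.-1 by rewrite mem_iota; lia.
rewrite inE mem_cat; apply/orP; right; apply/orP.
have [a0|a0] := leqP 2 (a o0); [left|right]; apply/mapP; exists (i : nat) => //;
  rewrite family_indexK; apply: mon4_eq => // m.
  have [<-|_] := eqVneq o0 m; first by rewrite ![_ == o0]eq_sym o01 o0k //; lia.
  have [<-|_] := eqVneq o1 m; first by rewrite [_ == o1]eq_sym o1k //; lia.
  by have [<-|_] := eqVneq i m; lia.
have [<-|_] := eqVneq o0 m; first by rewrite ![_ == o0]eq_sym o01 o0k //; lia.
have [<-|_] := eqVneq o1 m; first by rewrite [_ == o1]eq_sym o1k //; lia.
by have [<-|_] := eqVneq i m; lia.
Qed.

Lemma uniq_family_gens : uniq family_gens.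
Proof.
(* The exponent of x_1 separates the two lists, and the sum of the indices recovers i within
   each. *)
pose key (a : 'X_{1..n}) := (a o0, wdeg (fun i : 'I_n => val i) a).
have keyp (i : 'I_n) : 0 < i -> key (mon112 o0 o1 i) = (2, 1 + i).
  move=> i0; rewrite /key /mon112 !wdegD !wdeg1 /= e0 e1 !mnmDE !mnm1E eqxx eq_sym o01.
  by rewrite -val_eqE /= e0; case: (val i) i0.
have keyq (i : 'I_n) : 0 < i -> key (mon122 o0 o1 i) = (1, 2 + i).
  move=> i0; rewrite /key /mon122 !wdegD !wdeg1 /= e0 e1 !mnmDE !mnm1E eqxx eq_sym o01.
  by rewrite -val_eqE /= e0; case: (val i) i0.
have ge2 i : i \in iota 2 k.-1 -> 2 <= i by rewrite mem_iota => /andP[].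
apply: (@map_uniq _ _ key); rewrite map_cons map_cat -!map_comp keyp ?e1 //.
have -> : [seq (key \o (fun i => p i)) i | i <- iota 2 k.-1] = [seq (2, 1 + i) | i <- iota 2 k.-1].
  apply/eq_in_map => i ik /=; have vi := val_family_index ik.
  by rewrite keyp -[nat_of_ord _]/(val _) vi //; have := ge2 i ik; lia.
have -> : [seq (key \o (fun i => q i)) i | i <- iota 2 k.-1] = [seq (1, 2 + i) | i <- iota 2 k.-1].
  apply/eq_in_map => i ik /=; have vi := val_family_index ik.
  by rewrite keyq -[nat_of_ord _]/(val _) vi //; have := ge2 i ik; lia.
rewrite cons_uniq cat_uniq !map_inj_uniq ?iota_uniq /=; try by move=> i j [].
rewrite mem_cat negb_or; apply/and3P; split.
- by apply/andP; split; apply/mapP => -[i /ge2 i2 []]; lia.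
- by apply/hasPn => _ /mapP[i _ ->]; apply/mapP => -[j _ []].
by [].
Qed.

Lemma card_family_gens : #|` A| = (k.-1 + k.-1).+1.
Proof.
rewrite (card_fset_seq uniq_family_gens mem_family_gens).
by rewrite /= size_cat !size_map size_iota.
Qed.

(** The pairs with 2 <= i <= j <= k. *)
Definition index_pairs : seq (nat * nat) := [seq (i, j) | j <- iota 2 k.-1, i <- iota 2 j.-1].

Lemma size_index_pairs : size index_pairs = 'C(k, 2).
Proof.
rewrite size_allpairs_dep -[in RHS](prednK (ltnW k2)) -sumn_predn_iota; congr sumn.
by apply: eq_map => j; rewrite size_iota.
Qed.

Lemma mem_index_pairs i j : i \in iota 2 k.-1 -> j \in iota 2 k.-1 -> i <= j ->
  (i, j) \in index_pairs.
Proof.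
move=> ik jk ij; apply/allpairsPdep; exists j, i; split=> //.
by move: ik jk; rewrite !mem_iota; lia.
Qed.

Definition family_sums := (b + b)%MM
  :: [seq (b + p i)%MM | i <- iota 2 k.-1] ++ [seq (b + q i)%MM | i <- iota 2 k.-1]
  ++ [seq (p x.1 + p x.2)%MM | x <- index_pairs]
  ++ [seq (p x.1 + q x.2)%MM | x <- index_pairs]
  ++ [seq (q x.1 + q x.2)%MM | x <- index_pairs].

Lemma mem_family_sums c : c \in sumset A -> c \in family_sums.
Proof.
have bp i : i \in iota 2 k.-1 -> (b + p i)%MM \in family_sums.
  by move=> ik; rewrite inE !mem_cat (map_f (fun i => (b + p i)%MM)) ?orbT.
have bq i : i \in iota 2 k.-1 -> (b + q i)%MM \in family_sums.
  by move=> ik; rewrite inE !mem_cat (map_f (fun i => (b + q i)%MM)) ?orbT.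
have pp i j : i \in iota 2 k.-1 -> j \in iota 2 k.-1 -> (p i + p j)%MM \in family_sums.
  wlog ij : i j / i <= j => [W ik jk|ik jk].
    by case/orP: (leq_total i j) => /W; [|rewrite addmC]; apply.
  by rewrite inE !mem_cat (map_f (fun x => (p x.1 + p x.2)%MM) (mem_index_pairs ik jk ij)) ?orbT.
have qq i j : i \in iota 2 k.-1 -> j \in iota 2 k.-1 -> (q i + q j)%MM \in family_sums.
  wlog ij : i j / i <= j => [W ik jk|ik jk].
    by case/orP: (leq_total i j) => /W; [|rewrite addmC]; apply.
  by rewrite inE !mem_cat (map_f (fun x => (q x.1 + q x.2)%MM) (mem_index_pairs ik jk ij)) ?orbT.
(* This symmetry is what keeps the sumset small: mixed sums also need only the pairs with i <= j. *)
have pqC i j : (p i + q j = p j + q i)%MM.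
  by apply/mnmP=> l; rewrite !mnmDE; lia.
have pq i j : i \in iota 2 k.-1 -> j \in iota 2 k.-1 -> (p i + q j)%MM \in family_sums.
  wlog ij : i j / i <= j => [W ik jk|ik jk].
    by case/orP: (leq_total i j) => /W; [|rewrite pqC]; apply.
  by rewrite inE !mem_cat (map_f (fun x => (p x.1 + q x.2)%MM) (mem_index_pairs ik jk ij)) ?orbT.
case/sumsetP=> x [y []]; rewrite !mem_family_gens => xA yA ->; move: xA yA.
rewrite [x \in _]inE [y \in _]inE [x \in _ ++ _]mem_cat [y \in _ ++ _]mem_cat.
case/predU1P=> [->|/orP[]/mapP[i ik ->]]; case/predU1P=> [->|/orP[]/mapP[j jk ->]].
- exact: mem_head.
- exact: bp.
- exact: bq.
- by rewrite addmC; apply: bp.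
- exact: pp.
- exact: pq.
- by rewrite addmC; apply: bq.
- by rewrite addmC; apply: pq.
- exact: qq.
Qed.

(** Here |A| = 2k - 1 and |D| = k + 1, and there are at most 2k - 1 + 3 C(k, 2) sums, which equals
    (k + 1)(2k - 1) - C(k + 1, 2). *)
Lemma freiman_mon122 : freiman (kBorel_gen K 2 u).
Proof.
apply: (freiman_borel e0 e1 e2 mon122_bounded mon122_mdeg mon122_o0).
rewrite card_family_gens card_low_vars_mon122.
have le : #|` sumset A| <= size family_sums.
  by apply: uniq_leq_size => //; apply: mem_family_sums.
have sums : size family_sums = (k.-1 + (k.-1 + ('C(k, 2) + ('C(k, 2) + 'C(k, 2))))).+1.
  by rewrite /= !size_cat !size_map !size_iota size_index_pairs.
have bin2E N : 'C(N.+1, 2) * 2 = N.+1 * N.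
  by elim: N => // N IHN; rewrite binS bin1; lia.
move: le; rewrite {}sums -[nat_of_ord k](prednK (ltnW k2)); move: k.-1 => N /=.
by rewrite [in 'C(N.+2, 2)]binS bin1; have := bin2E N; nia.
Qed.

End FreimanFamily.

(** * The two monomials in three variables, and the classification *)

Lemma borel_seqs3_card1 :
  size (sum_seqs 3 [:: 4; 3; 2]) + 3 <= 3 * size (borel_seqs 3 [:: 4; 3; 2]).
Proof. by vm_compute. Qed.

(** These are the tails of x_2^2 x_3^2; the previous list belongs to x_1 x_2 x_3^2. *)
Lemma borel_seqs3_card2 :
  size (sum_seqs 3 [:: 4; 4; 2]) + 3 <= 3 * size (borel_seqs 3 [:: 4; 4; 2]).
Proof. by vm_compute. Qed.

Theorem theorem3p9 (n : nat) (hn : (3 <= n)%N) (K : fieldType)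
    (u : 'X_{1..n}) (hu : kbounded 2 u) (hdeg : mdeg u = 4%N)
    (hx1 : ~~ (xmon n [:: 1; 1] <= u)%MM) :
  freiman (kBorel_gen K 2 u) <->
    u = xmon n [:: 1; 2; 3; 3] \/
    u = xmon n [:: 2; 2; 3; 3] \/
    exists i4 : nat, (3 <= i4 <= n)%N /\ u = xmon n [:: 1; 2; 2; i4].
Proof.
pose o0 : 'I_n := Ordinal (ltnW (ltnW hn)); pose o1 : 'I_n := Ordinal (ltnW hn).
pose o2 : 'I_n := Ordinal hn.
have e0 : val o0 = 0 by []. have e1 : val o1 = 1 by []. have e2 : val o2 = 2 by [].
have u01 : u o0 <= 1.
  rewrite leqNgt; apply: contra hx1 => u0; apply/mnm_lepP=> i; rewrite mnmE /= !eqSS addn0.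
  by have [i0|_] := eqVneq 0 (val i); rewrite // (_ : i = o0) //; apply/val_inj.
have x1 : xmon n [:: 1; 2; 3; 3] = _ := xmon4 o0 o1 o2 o2.
have x2 : xmon n [:: 2; 2; 3; 3] = _ := xmon4 o1 o1 o2 o2.
have x3 (i : 'I_n) : xmon n [:: 1; 2; 2; i.+1] = _ := xmon4 o0 o1 o1 i.
split=> [fr|].
  have [->|->|[i i2 ->]|[t1 t2 t3]] := borel_gens_classification e0 e1 e2 hu hdeg u01.
  - by left.
  - by right; left.
  - by right; right; exists i.+1; rewrite x3 ltnS i2 ltn_ord.
  by case: (not_freiman_borel e0 e1 e2 hu hdeg u01 t1 t2 t3 fr).
have tE (i j k l : 'I_n) t : tail t (U_(i) + U_(j) + U_(k) + U_(l))%MM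
    = (t <= i) + (t <= j) + (t <= k) + (t <= l) by rewrite !tailD !tail1.
case=> [uE|[uE|[i4 [/andP[i3 i4n] uE]]]].
- apply: (freiman_three_vars e0 e1 e2 hu hdeg u01).
    by rewrite uE x1 tE.
  have -> : tail 1 u = 3 by rewrite uE x1 tE.
  have -> : tail 2 u = 2 by rewrite uE x1 tE.
  exact: borel_seqs3_card1.
- apply: (freiman_three_vars e0 e1 e2 hu hdeg u01).
    by rewrite uE x2 tE.
  have -> : tail 1 u = 4 by rewrite uE x2 tE.
  have -> : tail 2 u = 2 by rewrite uE x2 tE.
  exact: borel_seqs3_card2.
(* The statement numbers variables from 1, so the ordinal is the predecessor of its index. *)
case: i4 i3 i4n uE => // i4 i3 i4n ->; rewrite (x3 (Ordinal i4n)).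
exact: (freiman_mon122 K e0 e1 e2 (k := Ordinal i4n)).
Qed.
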